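(* Let $\mathcal{A}$ be a Hopf algebra and let $(\mathcal{E},d)$ be a bicovariant differential calculus over $\mathcal{A}$ such that the map ${}_0\sigma:{}_0\mathcal{E}\otimes_{\mathbb{C}}{}_0\mathcal{E}\to{}_0\mathcal{E}\otimes_{\mathbb{C}}{}_0\mathcal{E}$ is diagonalisable. Then there exists a bicovariant torsionless (right) connection on $\mathcal{E}$.
   Context: All vector spaces are over $\mathbb{C}$. $\mathcal{A}$ is a Hopf algebra with coproduct $\Delta$; Sweedler notation $\Delta(a)=a_{(1)}\otimes a_{(2)}$, left coactions $m\mapsto m_{(-1)}\otimes m_{(0)}$, right coactions $m\mapsto m_{(0)}\otimes m_{(1)}$. A left-covariant $\mathcal{A}$-bimodule is an $\mathcal{A}$-bimodule $M$ with a left comodule coaction $\Delta_M:M\to\mathcal{A}\otimes_{\mathbb{C}}M$ such that $\Delta_M(am)=\Delta(a)\Delta_M(m)$ and $\Delta_M(ma)=\Delta_M(m)\Delta(a)$. A right-covariant bimodule is defined in the same way with a right comodule coaction ${}_M\Delta:M\to M\otimes_{\mathbb{C}}\mathcal{A}$. A bicovariant bimodule has both structures, with $(\mathrm{id}\otimes{}_M\Delta)\Delta_M=(\Delta_M\otimes\mathrm{id}){}_M\Delta$. A linear map $T:M\to N$ is left-covariant if $(\mathrm{id}\otimes T)\Delta_M=\Delta_NT$, right-covariant if $(T\otimes\mathrm{id}){}_M\Delta={}_N\Delta T$, bicovariant if both. Put ${}_0M=\{m:\Delta_M(m)=1\otimes m\}$ and $M_0=\{m:{}_M\Delta(m)=m\otimes1\}$.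 $M\otimes_{\mathcal{A}}N$ carries the diagonal coactions $m\otimes n\mapsto m_{(-1)}n_{(-1)}\otimes(m_{(0)}\otimes n_{(0)})$ and $m\otimes n\mapsto(m_{(0)}\otimes n_{(0)})\otimes m_{(1)}n_{(1)}$. Recalled facts (Woronowicz, Schauenburg): the multiplication map ${}_0M\otimes_{\mathbb{C}}\mathcal{A}\to M$ is an isomorphism and ${}_0(M\otimes_{\mathcal{A}}N)={}_0M\otimes_{\mathbb{C}}{}_0N$. A first order differential calculus over $\mathcal{A}$ is an $\mathcal{A}$-bimodule $\mathcal{E}$ with a linear map $d:\mathcal{A}\to\mathcal{E}$ such that $d(ab)=(da)b+a\,db$ and every element of $\mathcal{E}$ is of the form $\sum_ka_kdb_k$. It is bicovariant if $\sum_ka_kdb_k=0$ implies both $\sum_k\Delta(a_k)(\mathrm{id}\otimes d)\Delta(b_k)=0$ and $\sum_k\Delta(a_k)(d\otimes\mathrm{id})\Delta(b_k)=0$; then $\mathcal{E}$ is a bicovariant bimodule with coactions determined by $\Delta_{\mathcal{E}}\circ d=(\mathrm{id}\otimes d)\Delta$ and ${}_{\mathcal{E}}\Delta\circ d=(d\otimes\mathrm{id})\Delta$. Standing assumption: ${}_0\mathcal{E}$ and $\mathcal{E}_0$ are finite-dimensional. $\sigma:\mathcal{E}\otimes_{\mathcal{A}}\mathcal{E}\to\mathcal{E}\otimes_{\mathcal{A}}\mathcal{E}$ is Woronowicz's canonical braiding: the unique bimodule homomorphism with $\sigma(\omega\otimes\eta)=\eta\otimes\omega$ for $\omega\in{}_0\mathcal{E}$,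 $\eta\in\mathcal{E}_0$. It is invertible, bicovariant and satisfies the braid equation. ${}_0\sigma$ is its restriction to ${}_0(\mathcal{E}\otimes_{\mathcal{A}}\mathcal{E})={}_0\mathcal{E}\otimes_{\mathbb{C}}{}_0\mathcal{E}$. $\Omega^2(\mathcal{A}):=(\mathcal{E}\otimes_{\mathcal{A}}\mathcal{E})/\mathrm{Ker}(\sigma-1)$ with quotient map $\wedge$; it inherits a bicovariant bimodule structure, and $d$ extends (Woronowicz) to a well-defined bicovariant map $d:\mathcal{E}\to\Omega^2(\mathcal{A})$, $d(\sum_ka_kdb_k)=\sum_kda_k\wedge db_k$, with $d(\omega a)=(d\omega)a-\omega\wedge da$. A (right) connection on $\mathcal{E}$ is a $\mathbb{C}$-linear map $\nabla:\mathcal{E}\to\mathcal{E}\otimes_{\mathcal{A}}\mathcal{E}$ with $\nabla(\rho a)=\nabla(\rho)a+\rho\otimes_{\mathcal{A}}da$ for all $\rho\in\mathcal{E}$, $a\in\mathcal{A}$. It is torsionless if $T_\nabla:=\wedge\circ\nabla+d:\mathcal{E}\to\Omega^2(\mathcal{A})$ vanishes. It is bicovariant if it is a bicovariant map from $\mathcal{E}$ to $\mathcal{E}\otimes_{\mathcal{A}}\mathcal{E}$. *)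

(* Defs.v *)
From HB Require Import structures.
From mathcomp Require Import all_boot all_order all_algebra.
From mathcomp Require Import boolp freeg.

Set Implicit Arguments.
Unset Strict Implicit.
Unset Printing Implicit Defensive.

Import GRing.Theory.
Local Open Scope ring_scope.
Local Open Scope quotient_scope.

(** * Quotients of vector spaces *)

Section Subspaces.
Variables (C : fieldType) (V : lmodType C).

Record subspace := Subspace {
  subspace_pred : {pred V};
  subspaceP : submod_closed subspace_pred }.

HB.instance Definition _ (U : subspace) :=
  GRing.isSubmodClosed.Build C V (subspace_pred U) (subspaceP U).

Definition in_span (S : V -> Prop) : pred V := fun v =>
  `[< exists2 s : seq (C * V),
        forall p, p \in s -> S p.2 & v = \sum_(p <- s) p.1 *: p.2 >].

Lemma in_span_closed S : submod_closed (in_span S).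
Proof.
split; first by apply/asboolP; exists [::]; rewrite ?big_nil.
move=> a u v /asboolP[s sS ->] /asboolP[t tS ->]; apply/asboolP.
exists ([seq (a * p.1, p.2) | p <- s] ++ t).
  by move=> p; rewrite mem_cat => /orP[/mapP[q qs ->]|/tS //]; apply: (sS q).
rewrite big_cat big_map /= scaler_sumr; congr (_ + _).
by apply: eq_bigr => p _; rewrite scalerA.
Qed.

Definition span S := Subspace (in_span_closed S).

Lemma mem_span (S : V -> Prop) v : S v -> subspace_pred (span S) v.
Proof.
move=> Sv; apply/asboolP; exists [:: (1, v)].
  by move=> p; rewrite inE => /eqP ->.
by rewrite big_seq1 scale1r.
Qed.

End Subspaces.

Lemma linear_bundle (C : fieldType) (V W : lmodType C) (f : V -> W) :
  linear f -> exists fL : {linear V -> W}, fL =1 f.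
Proof.
move=> flin; pose g := GRing.isLinear.Build C V W *:%R f flin.
by pose fL : {linear V -> W} := HB.pack f g; exists fL.
Qed.

Lemma ker_closed (C : fieldType) (V W : lmodType C) (f : {linear V -> W}) :
  submod_closed (fun v => f v == 0).
Proof.
split; first by rewrite unfold_in linear0.
by move=> a u v; rewrite !unfold_in linearP => /eqP -> /eqP ->; rewrite scaler0 addr0.
Qed.

Definition ker (C : fieldType) (V W : lmodType C) (f : {linear V -> W}) :=
  Subspace (ker_closed f).

Section Quotients.
Variables (C : fieldType) (V : lmodType C) (U : subspace V).

Definition quot : Type := @Quotient.quot V (subspace_pred U).

HB.instance Definition _ := GRing.Zmodule.on quot.

Definition proj (v : V) : quot := \pi_(@Quotient.quot V (subspace_pred U)) v.
Definition lift_repr (x : quot) : V :=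
  @repr _ (@Quotient.quot V (subspace_pred U)) x.

Lemma lift_reprK : cancel lift_repr proj. Proof. exact: reprK. Qed.

Lemma projP u v : (proj u = proj v) <-> (subspace_pred U (u - v)).
Proof.
rewrite -[subspace_pred U _]/(u - v \in subspace_pred U) Quotient.idealrBE.
by split=> [|/eqP //]; move/eqP.
Qed.

Lemma projD u v : proj (u + v) = proj u + proj v.
Proof. by rewrite /proj piE. Qed.

Lemma proj_reprB v : subspace_pred U (lift_repr (proj v) - v).
Proof. by apply/projP; rewrite lift_reprK. Qed.

Definition qscale (c : C) (x : quot) : quot := proj (c *: lift_repr x).

Lemma proj_scale c v : proj (c *: v) = qscale c (proj v).
Proof.
apply/esym/projP; rewrite -scalerBr.
rewrite -[subspace_pred U _]/(c *: (lift_repr (proj v) - v) \in subspace_pred U).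
exact/rpredZ/proj_reprB.
Qed.

Lemma qscaleA a b x : qscale a (qscale b x) = qscale (a * b) x.
Proof. by rewrite -[x]lift_reprK -!proj_scale scalerA. Qed.
Lemma qscale1 : left_id 1 qscale.
Proof. by move=> x; rewrite -[x]lift_reprK -!proj_scale scale1r. Qed.
Lemma qscaleDr : right_distributive qscale +%R.
Proof.
move=> a x y; rewrite -[x]lift_reprK -[y]lift_reprK.
by rewrite -projD -!proj_scale -projD scalerDr.
Qed.
Lemma qscaleDl x : {morph qscale^~ x : a b / a + b}.
Proof. by move=> a b; rewrite -[x]lift_reprK -!proj_scale -projD scalerDl. Qed.

HB.instance Definition _ :=
  GRing.Zmodule_isLmodule.Build C quot qscaleA qscale1 qscaleDr qscaleDl.

Lemma proj_linear : linear proj.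
Proof. by move=> c u v; rewrite projD proj_scale. Qed.
HB.instance Definition _ := GRing.isLinear.Build C V quot *:%R proj proj_linear.

(* The map induced by [f] on the quotient; meaningful when [f] is linear and
   vanishes on [U], see [quot_liftE]. *)
Definition quot_lift (W : Type) (f : V -> W) (x : quot) : W := f (lift_repr x).

Lemma quot_liftE (W : lmodType C) (f : V -> W) :
  linear f -> (forall u, subspace_pred U u -> f u = 0) ->
  forall v, quot_lift f (proj v) = f v.
Proof.
move=> flin f0 v; pose g := GRing.isLinear.Build C V W *:%R f flin.
pose fL : {linear V -> W} := HB.pack f g.
apply/eqP; rewrite -subr_eq0 /quot_lift -[f]/(fL : V -> W) -linearB.
by apply/eqP; exact: f0 (proj_reprB v).
Qed.

Lemma quot_lift_linear (W : lmodType C) (f : V -> W) :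
  linear f -> (forall u, subspace_pred U u -> f u = 0) -> linear (quot_lift f).
Proof.
move=> flin f0 c x y; rewrite -[x]lift_reprK -[y]lift_reprK.
by rewrite -proj_linear !(quot_liftE flin f0) flin.
Qed.

End Quotients.

(** * Tensor products over the base field *)

Section Tensor.
Variables (C : fieldType) (M N : lmodType C).

(* [<< (m, n) >>] is the generator indexed by [(m, n)] of the free vector space
   on [M * N]. *)
Inductive tens_rel : {freeg (M * N)%type / C} -> Prop :=
| TensDl m m' n :
    tens_rel (<< (m + m', n) >> - << (m, n) >> - << (m', n) >>)
| TensDr m n n' :
    tens_rel (<< (m, n + n') >> - << (m, n) >> - << (m, n') >>)
| TensZl c m n : tens_rel (<< (c *: m, n) >> - c *: << (m, n) >>)
| TensZr c m n : tens_rel (<< (m, c *: n) >> - c *: << (m, n) >>).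

Definition tensor : Type := quot (span tens_rel).
HB.instance Definition _ := GRing.Lmodule.on tensor.

Definition tens_proj : {freeg (M * N)%type / C} -> tensor :=
  proj (span tens_rel).
Lemma tens_proj_linear : linear tens_proj. Proof. exact: proj_linear. Qed.
HB.instance Definition _ :=
  GRing.isLinear.Build C {freeg (M * N)%type / C} tensor *:%R tens_proj
    tens_proj_linear.

Definition otimes (m : M) (n : N) : tensor := tens_proj << (m, n) >>.

Definition bilinear_map (W : lmodType C) (f : M -> N -> W) :=
  (forall n, linear (f^~ n)) /\ (forall m, linear (f m)).

Lemma otimes_bilinear : bilinear_map otimes.
Proof.
have prS u : tens_rel u -> tens_proj u = 0.
  move=> Su; rewrite -[RHS](linear0 tens_proj); apply/projP.
  by rewrite subr0; apply: mem_span.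
split=> [n c m m'|m c n n'].
- have := prS _ (TensDl (c *: m) m' n); rewrite !linearB /=.
  move/eqP; rewrite subr_eq0 subr_eq addrC => /eqP.
  rewrite -!/(otimes _ _) => ->; congr (_ + _).
  have := prS _ (TensZl c m n); rewrite linearB linearZ /=.
  by move/eqP; rewrite subr_eq0 => /eqP.
have := prS _ (TensDr m (c *: n) n'); rewrite !linearB /=.
move/eqP; rewrite subr_eq0 subr_eq addrC => /eqP.
rewrite -!/(otimes _ _) => ->; congr (_ + _).
have := prS _ (TensZr c m n); rewrite linearB linearZ /=.
by move/eqP; rewrite subr_eq0 => /eqP.
Qed.

Lemma fglift_linear (W : lmodType C) (f : M * N -> W) : linear (fglift f).
Proof.
pose g := GRing.isZmodMorphism.Build {freeg (M * N)%type / C} W (fglift f)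
  (lift_is_additive f).
pose fA : {additive {freeg (M * N)%type / C} -> W} := HB.pack (fglift f) g.
move=> c u v; rewrite -[fglift f]/(fA : _ -> _) raddfD; congr (_ + _).
transitivity (\sum_(z <- dom u) fA << c * coeff z u *g z >>).
  by rewrite -raddf_sum.
rewrite -[in RHS](freeg_sumE u) raddf_sum scaler_sumr.
by apply: eq_bigr => z _; rewrite /= !liftU scalerA.
Qed.

(* The linear map sending the tensor of [m] and [n] to [f m n]; meaningful when
   [f] is bilinear, see [tens_liftE]. *)
Definition tens_lift (W : lmodType C) (f : M -> N -> W) : tensor -> W :=
  quot_lift (fglift (fun p => f p.1 p.2)).

Lemma fglift_rel (W : lmodType C) (f : M -> N -> W) (u : {freeg (M * N) / C}) :
  bilinear_map f -> subspace_pred (span tens_rel) u ->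
  fglift (fun p => f p.1 p.2) u = 0.
Proof.
move=> [fl fr] /asboolP[s sS ->].
have [fL fLE] := linear_bundle (fglift_linear (fun p => f p.1 p.2)).
rewrite -fLE linear_sum big_seq big1 // => p /sS rp.
rewrite linearZ; apply/eqP; rewrite scaler_eq0; apply/orP; right.
have fU m n : fL << (m, n) >> = f m n by rewrite fLE liftU scale1r.
case: rp => [m m' n|m n n'|c m n|c m n];
  rewrite !linearB ?linearZ !fU.
- have := fl n 1 m m'; rewrite !scale1r => ->.
  by rewrite -addrA -opprD subrr.
- have := fr m 1 n n'; rewrite !scale1r => ->.
  by rewrite -addrA -opprD subrr.
- have := fl n c m 0; rewrite !addr0 => ->.
  have := fl n (-1) 0 0; rewrite scaler0 addr0 scaleN1r => ->.
  by rewrite addNr addr0 /= scalerN subrr.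
have := fr m c n 0; rewrite !addr0 => ->.
have := fr m (-1) 0 0; rewrite scaler0 addr0 scaleN1r => ->.
by rewrite addNr addr0 /= scalerN subrr.
Qed.

Lemma tens_liftE (W : lmodType C) (f : M -> N -> W) m n :
  bilinear_map f -> tens_lift f (otimes m n) = f m n.
Proof.
move=> fb; rewrite /tens_lift quot_liftE; first by rewrite liftU scale1r.
  exact: fglift_linear.
by move=> u; apply: fglift_rel.
Qed.

Lemma tens_lift_linear (W : lmodType C) (f : M -> N -> W) :
  bilinear_map f -> linear (tens_lift f).
Proof.
move=> fb; apply: quot_lift_linear; first exact: fglift_linear.
by move=> u; apply: fglift_rel.
Qed.

Lemma tensorP (t : tensor) :
  exists s : seq (M * N), t = \sum_(p <- s) otimes p.1 p.2.
Proof.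
rewrite -[t](lift_reprK t) -[lift_repr t]freeg_sumE.
rewrite -/(tens_proj _) linear_sum.
exists [seq (coeff z (lift_repr t) *: z.1, z.2) | z <- dom (lift_repr t)].
rewrite [RHS]big_map; apply: eq_bigr => -[m n] _ /=.
set c := coeff _ _; have -> : << c *g (m, n) >> = c *: << (m, n) >>.
  by apply/eqP/freeg_eqP => z; rewrite coeffZ !coeffU mul1r.
rewrite linearZ /= -/(otimes m n).
have [tl _] := otimes_bilinear.
by have := tl n c m 0; have := tl n (-1) 0 0;
   rewrite scaler0 !addr0 scaleN1r => ->; rewrite addNr !addr0.
Qed.

End Tensor.

Section TensorMaps.
Variable C : fieldType.

Definition tens_map (M N M' N' : lmodType C) (f : M -> M') (g : N -> N') :
    tensor M N -> tensor M' N' :=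
  tens_lift (fun m n => otimes (f m) (g n)).

(* The bilinear map sending the tensor of [x] and [y], and the tensor of [m]
   and [n], to the tensor of [f x m] and [g y n]. *)
Definition tens_map2 (X Y M N M' N' : lmodType C)
    (f : X -> M -> M') (g : Y -> N -> N') (t : tensor X Y) (u : tensor M N) :
    tensor M' N' :=
  tens_lift (fun x y => tens_map (f x) (g y) u) t.

Definition tens_assoc (L M N : lmodType C) :
    tensor (tensor L M) N -> tensor L (tensor M N) :=
  tens_lift (fun t n => tens_lift (fun l m => otimes l (otimes m n)) t).

End TensorMaps.

(** * Hopf algebras *)

Record hopfAlgebra (C : fieldType) := HopfAlgebra {
  hopf_alg :> algType C;
  comul : {linear hopf_alg -> tensor hopf_alg hopf_alg};
  counit : {lrmorphism hopf_alg -> C^o};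
  antipode : {linear hopf_alg -> hopf_alg};
  comul1 : comul 1 = otimes 1 1;
  comulM : forall a b, comul (a * b) = tens_map2 *%R *%R (comul a) (comul b);
  comulA : forall a,
    tens_assoc (tens_map comul idfun (comul a)) = tens_map idfun comul (comul a);
  counitl : forall a, tens_lift (fun x y => (counit x : C) *: y) (comul a) = a;
  counitr : forall a, tens_lift (fun x y => (counit y : C) *: x) (comul a) = a;
  antipodel : forall a,
    tens_lift (fun x y => antipode x * y) (comul a) = (counit a : C) *: 1;
  antipoder : forall a,
    tens_lift (fun x y => x * antipode y) (comul a) = (counit a : C) *: 1 }.

(** * Bimodules and their tensor products *)

Record bimodule (C : fieldType) (A : algType C) := Bimodule {
  bim_sort :> lmodType C;
  lact : A -> bim_sort -> bim_sort;
  ract : bim_sort -> A -> bim_sort;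
  lact_bilinear : bilinear_map lact;
  ract_bilinear : bilinear_map ract;
  lact1 : forall m, lact 1 m = m;
  ract1 : forall m, ract m 1 = m;
  lactM : forall a b m, lact (a * b) m = lact a (lact b m);
  ractM : forall m a b, ract m (a * b) = ract (ract m a) b;
  lractA : forall a m b, ract (lact a m) b = lact a (ract m b) }.

Definition bimodule_map (C : fieldType) (A : algType C) (M N : bimodule A)
    (f : M -> N) :=
  [/\ linear f,
      forall a m, f (lact a m) = lact a (f m) &
      forall m a, f (ract m a) = ract (f m) a].

Section TensorA.
Variables (C : fieldType) (A : algType C) (M N : bimodule A).

Inductive balance_rel : tensor M N -> Prop :=
| Balance m a n : balance_rel (otimes (ract m a) n - otimes m (lact a n)).

Definition tensorA : Type := quot (span balance_rel).
HB.instance Definition _ := GRing.Lmodule.on tensorA.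

Definition tensA_proj : tensor M N -> tensorA := proj (span balance_rel).
Lemma tensA_proj_linear : linear tensA_proj. Proof. exact: proj_linear. Qed.
HB.instance Definition _ :=
  GRing.isLinear.Build C (tensor M N) tensorA *:%R tensA_proj tensA_proj_linear.

Definition otimesA (m : M) (n : N) : tensorA := tensA_proj (otimes m n).

(* The linear map on the tensor product over [A] induced by [f]; meaningful when
   [f] is bilinear and balanced, see [tensA_liftE]. *)
Definition tensA_lift (W : lmodType C) (f : M -> N -> W) : tensorA -> W :=
  quot_lift (tens_lift f).

Definition balanced (W : lmodType C) (f : M -> N -> W) :=
  bilinear_map f /\ forall m a n, f (ract m a) n = f m (lact a n).

Lemma tens_lift_balance (W : lmodType C) (f : M -> N -> W) u :
  balanced f -> subspace_pred (span balance_rel) u -> tens_lift f u = 0.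
Proof.
move=> [fb fA] /asboolP[s sS ->].
have [fL fLE] := linear_bundle (tens_lift_linear fb).
rewrite -fLE linear_sum big_seq big1 // => p /sS[m a n].
by rewrite linearZ linearB /= !fLE !tens_liftE // fA subrr scaler0.
Qed.

Lemma tensA_liftE (W : lmodType C) (f : M -> N -> W) m n :
  balanced f -> tensA_lift f (otimesA m n) = f m n.
Proof.
move=> fb; rewrite /tensA_lift quot_liftE; first exact: (tens_liftE _ _ fb.1).
  exact: (tens_lift_linear fb.1).
by move=> u; apply: tens_lift_balance.
Qed.

Lemma tensA_lift_linear (W : lmodType C) (f : M -> N -> W) :
  balanced f -> linear (tensA_lift f).
Proof.
move=> fb; apply: quot_lift_linear; first exact: (tens_lift_linear fb.1).
by move=> u; apply: tens_lift_balance.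
Qed.

Lemma otimesA_balanced : balanced otimesA.
Proof.
have [tl tr] := otimes_bilinear M N.
split; first split=> [n|m] c x y.
- by rewrite /otimesA tl /tensA_proj linearP.
- by rewrite /otimesA tr /tensA_proj linearP.
move=> m a n; apply/projP; apply: mem_span; exact: Balance.
Qed.

Lemma tensorAP (t : tensorA) :
  exists s : seq (M * N), t = \sum_(p <- s) otimesA p.1 p.2.
Proof.
rewrite -[t](lift_reprK t); have [s ->] := tensorP (lift_repr t).
by exists s; rewrite -/(tensA_proj _) linear_sum.
Qed.

Definition tensA_lact (a : A) : tensorA -> tensorA :=
  tensA_lift (fun m n => otimesA (lact a m) n).
Definition tensA_ract (t : tensorA) (a : A) : tensorA :=
  tensA_lift (fun m n => otimesA m (ract n a)) t.

Let lact_balanced a : balanced (fun m n => otimesA (lact a m) n).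
Proof.
have [[tl tr] tA] := otimesA_balanced.
split; first split=> [n|m] c x y.
- by rewrite (lact_bilinear M).2 tl.
- by rewrite tr.
by move=> m b n; rewrite -lractA tA.
Qed.

Let ract_balanced a : balanced (fun m n => otimesA m (ract n a)).
Proof.
have [[tl tr] tA] := otimesA_balanced.
split; first split=> [n|m] c x y.
- by rewrite tl.
- by rewrite (ract_bilinear N).1 tr.
by move=> m b n; rewrite lractA tA.
Qed.

Let lactE a m n : tensA_lact a (otimesA m n) = otimesA (lact a m) n.
Proof. exact: (tensA_liftE _ _ (lact_balanced a)). Qed.

Let ractE m n a : tensA_ract (otimesA m n) a = otimesA m (ract n a).
Proof. exact: (tensA_liftE _ _ (ract_balanced a)). Qed.

Let tensA_ext (f g : tensorA -> tensorA) :
  linear f -> linear g ->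
  (forall m n, f (otimesA m n) = g (otimesA m n)) -> f =1 g.
Proof.
move=> fl gl fg t; have [s ->] := tensorAP t.
have [[fL fLE] [gL gLE]] := (linear_bundle fl, linear_bundle gl).
rewrite -fLE -gLE !linear_sum.
by apply: eq_bigr => p _; rewrite fLE gLE.
Qed.

Let lact_lin a : linear (tensA_lact a).
Proof. exact: tensA_lift_linear. Qed.

Let ract_lin a : linear (tensA_ract^~ a).
Proof. exact: tensA_lift_linear. Qed.

Let comp_lin (f g : tensorA -> tensorA) : linear f -> linear g -> linear (f \o g).
Proof. by move=> fl gl c x y /=; rewrite gl fl. Qed.

Let comb_lin c (f g : tensorA -> tensorA) :
  linear f -> linear g -> linear (fun t => c *: f t + g t).
Proof.
move=> fl gl e x y; rewrite fl gl !scalerDr !scalerA (mulrC c) addrACA.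
by [].
Qed.

Let id_lin : linear (fun t : tensorA => t). Proof. by []. Qed.

Lemma tensA_lact_bilinear : bilinear_map tensA_lact.
Proof.
split=> [t c a b|//]; move: t; apply: tensA_ext => [//||m n]; first exact: comb_lin.
by rewrite !lactE (lact_bilinear M).1 otimesA_balanced.1.1.
Qed.

Lemma tensA_ract_bilinear : bilinear_map tensA_ract.
Proof.
split=> [//|t c a b]; move: t; apply: tensA_ext => [//||m n]; first exact: comb_lin.
by rewrite !ractE (ract_bilinear N).2 otimesA_balanced.1.2.
Qed.

Lemma tensA_lact1 t : tensA_lact 1 t = t.
Proof. by move: t; apply: tensA_ext => // m n; rewrite lactE lact1. Qed.

Lemma tensA_ract1 t : tensA_ract t 1 = t.
Proof. by move: t; apply: tensA_ext => // m n; rewrite ractE ract1. Qed.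

Lemma tensA_lactM a b t : tensA_lact (a * b) t = tensA_lact a (tensA_lact b t).
Proof.
move: t; apply: tensA_ext => [//||m n]; last by rewrite !lactE lactM.
exact: (comp_lin (lact_lin a) (lact_lin b)).
Qed.

Lemma tensA_ractM t a b : tensA_ract t (a * b) = tensA_ract (tensA_ract t a) b.
Proof.
move: t; apply: tensA_ext => [//||m n]; last by rewrite !ractE ractM.
exact: (comp_lin (ract_lin b) (ract_lin a)).
Qed.

Lemma tensA_lractA a t b :
  tensA_ract (tensA_lact a t) b = tensA_lact a (tensA_ract t b).
Proof.
move: t; apply: tensA_ext => [||m n]; last by rewrite lactE !ractE lactE.
- exact: (comp_lin (ract_lin b) (lact_lin a)).
- exact: (comp_lin (lact_lin a) (ract_lin b)).
Qed.

Definition tensor_bimod : bimodule A :=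
  Bimodule tensA_lact_bilinear tensA_ract_bilinear tensA_lact1 tensA_ract1
    tensA_lactM tensA_ractM tensA_lractA.

End TensorA.

(** * Coactions and covariance *)

Section Covariance.
Variables (C : fieldType) (A : hopfAlgebra C).

Definition left_invariant (M : lmodType C) (delta : M -> tensor A M) (m : M) :=
  delta m = otimes 1 m.
Definition right_invariant (M : lmodType C) (rho : M -> tensor M A) (m : M) :=
  rho m = otimes m 1.

Definition diag_lcoact (M N : bimodule A) (deltaM : M -> tensor A M)
    (deltaN : N -> tensor A N) : tensor_bimod M N -> tensor A (tensor_bimod M N) :=
  tensA_lift (fun m n => tens_map2 *%R (@otimesA C A M N) (deltaM m) (deltaN n)).
Definition diag_rcoact (M N : bimodule A) (rhoM : M -> tensor M A)
    (rhoN : N -> tensor N A) : tensor_bimod M N -> tensor (tensor_bimod M N) A :=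
  tensA_lift (fun m n => tens_map2 (@otimesA C A M N) *%R (rhoM m) (rhoN n)).

Definition left_covariant (M N : lmodType C) (deltaM : M -> tensor A M)
    (deltaN : N -> tensor A N) (T : M -> N) :=
  forall m, tens_map idfun T (deltaM m) = deltaN (T m).
Definition right_covariant (M N : lmodType C) (rhoM : M -> tensor M A)
    (rhoN : N -> tensor N A) (T : M -> N) :=
  forall m, tens_map T idfun (rhoM m) = rhoN (T m).

End Covariance.

Section LinearAlgebra.
Variables (C : fieldType) (V : lmodType C) (P : V -> Prop).

Definition spans (n : nat) (v : 'I_n -> V) :=
  (forall i, P (v i)) /\
  forall x, P x -> exists c : 'I_n -> C, x = \sum_(i < n) c i *: v i.

Definition finite_dimensional := exists n (v : 'I_n -> V), spans v.

Definition lin_independent (n : nat) (v : 'I_n -> V) :=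
  forall c : 'I_n -> C, \sum_(i < n) c i *: v i = 0 -> forall i, c i = 0.

(* The restriction of [f] to the subspace [P] is diagonalisable: [P] has a basis
   of eigenvectors of [f]. *)
Definition diagonalisable_on (f : V -> V) :=
  exists n (v : 'I_n -> V),
    [/\ spans v, lin_independent v & forall i, exists l : C, f (v i) = l *: v i].

End LinearAlgebra.

(** * First order differential calculi *)

Record calculus (C : fieldType) (A : algType C) := Calculus {
  calc_bim :> bimodule A;
  calc_d : {linear A -> calc_bim};
  calc_leibniz : forall a b,
    calc_d (a * b) = ract (calc_d a) b + lact a (calc_d b);
  calc_gen : forall w : calc_bim, exists s : seq (A * A),
    w = \sum_(p <- s) lact p.1 (calc_d p.2) }.

Section Calculus.
Variables (C : fieldType) (A : algType C) (E : calculus A).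

Definition presentation (w : E) : seq (A * A) := sval (cid (calc_gen w)).

Lemma presentationE (w : E) :
  w = \sum_(p <- presentation w) lact p.1 (calc_d E p.2).
Proof. exact: svalP (cid (calc_gen w)). Qed.

(* The additive map sending [\sum_k a_k d b_k] to [\sum_k F a_k b_k]; meaningful
   when the latter depends only on the former, see [calc_extE]. *)
Definition calc_ext (W : lmodType C) (F : A -> A -> W) (w : E) : W :=
  \sum_(p <- presentation w) F p.1 p.2.

Lemma calc_extE (W : lmodType C) (F : A -> A -> W) :
  (forall a b, F (- a) b = - F a b) ->
  (forall s : seq (A * A), \sum_(p <- s) lact p.1 (calc_d E p.2) = 0 ->
     \sum_(p <- s) F p.1 p.2 = 0) ->
  forall s : seq (A * A),
    calc_ext F (\sum_(p <- s) lact p.1 (calc_d E p.2)) = \sum_(p <- s) F p.1 p.2.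
Proof.
move=> FN F0 s; set w := \sum_(p <- s) _; apply/eqP; rewrite -subr_eq0.
have /F0 : \sum_(p <- presentation w ++ [seq (- p.1, p.2) | p <- s])
             lact p.1 (calc_d E p.2) = 0.
  rewrite big_cat big_map /= -presentationE.
  rewrite (eq_bigr (fun p => - lact p.1 (calc_d E p.2))).
    by rewrite sumrN subrr.
  move=> p _; have := (lact_bilinear E).1 (calc_d E p.2) (-1) p.1 0.
  have := (lact_bilinear E).1 (calc_d E p.2) (-1) 0 0.
  by rewrite scaler0 addr0 !scaleN1r addNr => ->; rewrite !addr0.
by rewrite big_cat big_map /= (eq_bigr _ (fun p _ => FN p.1 p.2)) sumrN => ->.
Qed.

End Calculus.

Section BicovariantCalculus.
Variables (C : fieldType) (A : hopfAlgebra C) (E : calculus A).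
Local Notation d := (calc_d E).

Definition lcoact_term (a b : A) : tensor A E :=
  tens_map2 *%R (@lact C A E) (comul A a) (tens_map idfun d (comul A b)).
Definition rcoact_term (a b : A) : tensor E A :=
  tens_map2 (@lact C A E) *%R (comul A a) (tens_map d idfun (comul A b)).

Definition bicovariant_calculus :=
  forall s : seq (A * A), \sum_(p <- s) lact p.1 (d p.2) = 0 ->
    \sum_(p <- s) lcoact_term p.1 p.2 = 0 /\
    \sum_(p <- s) rcoact_term p.1 p.2 = 0.

(* By [bicovariant_calculus] these are the coactions determined by
   [lcoact (d b) = (id (x) d) (comul b)] and [rcoact (d b) = (d (x) id) (comul b)]. *)
Definition lcoact : E -> tensor A E := calc_ext lcoact_term.
Definition rcoact : E -> tensor E A := calc_ext rcoact_term.

Definition lcoact2 : tensor_bimod E E -> tensor A (tensor_bimod E E) :=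
  diag_lcoact lcoact lcoact.
Definition rcoact2 : tensor_bimod E E -> tensor (tensor_bimod E E) A :=
  diag_rcoact rcoact rcoact.

Definition canonical_braiding (sigma : tensor_bimod E E -> tensor_bimod E E) :=
  bimodule_map sigma /\
  forall w eta : E, left_invariant lcoact w -> right_invariant rcoact eta ->
    sigma (otimesA w eta) = otimesA eta w.

Variable sigma : {linear tensor_bimod E E -> tensor_bimod E E}.

(* The quotient by [Ker (sigma - 1)]. *)
Definition Omega2 : lmodType C := quot (ker (sigma \- idfun)).

Definition wedge : tensor_bimod E E -> Omega2 := proj (ker (sigma \- idfun)).

(* The extension [\sum_k a_k d b_k |-> \sum_k d a_k /\ d b_k] of [d]. *)
Definition ext_d : E -> Omega2 := calc_ext (fun a b => wedge (otimesA (d a) (d b))).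

Definition torsion (nabla : E -> tensor_bimod E E) (w : E) : Omega2 :=
  wedge (nabla w) + ext_d w.

Definition torsionless (nabla : E -> tensor_bimod E E) := forall w, torsion nabla w = 0.

End BicovariantCalculus.

Definition right_connection (C : fieldType) (A : algType C) (E : calculus A)
    (nabla : E -> tensor_bimod E E) :=
  linear nabla /\
  forall (r : E) (a : A),
    nabla (ract r a) = ract (nabla r) a + otimesA r (calc_d E a).

Arguments lcoact {C A} E _.
Arguments rcoact {C A} E _.
Arguments lcoact2 {C A} E _.
Arguments rcoact2 {C A} E _.

Definition bicovariant_connection (C : fieldType) (A : hopfAlgebra C)
    (E : calculus A) (nabla : E -> tensor_bimod E E) :=
  left_covariant (lcoact E) (lcoact2 E) nabla /\
  right_covariant (rcoact E) (rcoact2 E) nabla.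

(* Main.v *)
Require Import Defs.
From mathcomp Require Import all_boot all_order all_algebra.
From mathcomp Require Import boolp freeg.
From mathcomp Require Import reals complex.

Set Implicit Arguments.
Unset Strict Implicit.
Unset Printing Implicit Defensive.

Import GRing.Theory.
Local Open Scope ring_scope.

(* Write [om a = S(a_1) da_2] and [et b = db_1 S(b_2)]; these forms are left-,
   respectively right-invariant, [da = a_1 om(a_2)] and [db = et(b_1) b_2], so
   [sigma (da (x) db) = a_1 et(b_1) (x) om(a_2) b_2]. Expanding with the Leibniz
   rule,
     [sigma (da (x) db) - da (x) db = a_1 db_1 (x) om(a_2 b_2) - d(a b_1) (x) om(b_2)],
   which depends only on the right and left coactions of [a db]. Hence [sigma]
   fixes [\sum da_k (x) db_k] as soon as [\sum a_k db_k = 0].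

   As [E (x)_A E] is generated as a left module by the left-invariant elements
   [om a (x) om b], diagonalisability makes a polynomial [P] in [sigma] a
   bicovariant bimodule projection of [E (x)_A E] onto [Ker (sigma - 1)]. Then
     [D (\sum a_k db_k) = (1 - P) (\sum da_k (x) db_k)]
   is well defined and lifts [d : E -> Omega2], and with the bicovariant
   connection [nabla0 m = m_(0) S(m_(1)) (x) d m_(2)], which kills [E_0], the
   map [P nabla0 - D] is a bicovariant torsionless connection. *)

(** * Sweedler sums *)

(* [\sw_(a1, a2 <- Delta a) F a1 a2] is the Sweedler sum [F(a_(1), a_(2))]. It is
   always linear in [F], but linear in the tensor only when [F] is bilinear. *)
Reserved Notation "\sw_ ( x , y <- t ) F"
  (at level 41, F at level 41, x, y at level 0, t at level 50,
   format "'[' \sw_ ( x ,  y  <-  t ) '/  '  F ']'").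
Notation "\sw_ ( x , y <- t ) F" := (tens_lift (fun x y => F) t) : ring_scope.

Section TensorSums.
Variable C : fieldType.
Implicit Types M N V W : lmodType C.

(** The lemmas up to [lin_sum] take linearity as a hypothesis: lifts and coactions are bare
    functions, often linear only under assumptions such as bicovariance. *)
Lemma linD V W (f : V -> W) u v : linear f -> f (u + v) = f u + f v.
Proof. by move=> fl; have := fl 1 u v; rewrite !scale1r. Qed.

Lemma lin0 V W (f : V -> W) : linear f -> f 0 = 0.
Proof. by move=> /linear_bundle[g gE]; rewrite -gE linear0. Qed.

Lemma linZ V W (f : V -> W) c u : linear f -> f (c *: u) = c *: f u.
Proof. by move=> /linear_bundle[g gE]; rewrite -!gE linearZ. Qed.

Lemma linB V W (f : V -> W) u v : linear f -> f (u - v) = f u - f v.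
Proof. by move=> /linear_bundle[g gE]; rewrite -!gE linearB. Qed.

Lemma linN V W (f : V -> W) u : linear f -> f (- u) = - f u.
Proof. by move=> /linear_bundle[g gE]; rewrite -!gE linearN. Qed.

Lemma lin_sum V W (f : V -> W) I (r : seq I) (P : pred I) F :
  linear f -> f (\sum_(i <- r | P i) F i) = \sum_(i <- r | P i) f (F i).
Proof.
move=> fl; apply: (big_morph f (id1 := 0) (op1 := +%R)) => [u v|].
  exact: linD.
exact: lin0.
Qed.

(** [tens_lift] evaluates [f] on a chosen representative of [t], so one list of weighted pairs
    serves all [f] at once, bilinear or not. The rules for congruence, exchange and linearity in the
    summand then need no bilinearity. *)
Lemma sw_sum M N (t : tensor M N) :
  exists s : seq (C * (M * N)), forall W (f : M -> N -> W),
    tens_lift f t = \sum_(p <- s) p.1 *: f p.2.1 p.2.2.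
Proof.
exists [seq (coeff z (lift_repr t), z) | z <- dom (lift_repr t)] => W' g.
rewrite /tens_lift /quot_lift -[in LHS](freeg_sumE (lift_repr t)).
rewrite (lin_sum _ _ _ (fglift_linear _)) [RHS]big_map; apply: eq_bigr => z _.
by rewrite liftU.
Qed.

Lemma eq_sw M N W (f g : M -> N -> W) t :
  (forall x y, f x y = g x y) -> tens_lift f t = tens_lift g t.
Proof.
move=> fg; have [s sE] := sw_sum t; rewrite !sE.
by apply: eq_bigr => p _; rewrite fg.
Qed.

Lemma sw_lin M N V W (g : V -> W) (f : M -> N -> V) t :
  linear g -> g (tens_lift f t) = \sw_(x, y <- t) g (f x y).
Proof.
move=> gl; have [s sE] := sw_sum t; rewrite !sE lin_sum //.
by apply: eq_bigr => p _; rewrite linZ.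
Qed.

Lemma sw_exchange M N M' N' W (f : M -> N -> M' -> N' -> W) t u :
  \sw_(x, y <- t) \sw_(x', y' <- u) f x y x' y' =
  \sw_(x', y' <- u) \sw_(x, y <- t) f x y x' y'.
Proof.
have [s sE] := sw_sum t.
have [r rE] := sw_sum u.
rewrite sE rE; under eq_bigr do rewrite rE scaler_sumr.
under [RHS]eq_bigr do rewrite sE scaler_sumr.
rewrite exchange_big /=; apply: eq_bigr => p _; apply: eq_bigr => q _.
by rewrite !scalerA mulrC.
Qed.

(** Turns an equation between tensors, such as a covariance condition, into an equation between
    Sweedler sums, with [otimes] as generic bilinear summand. *)
Lemma sw_otimes M N (t : tensor M N) : \sw_(x, y <- t) otimes x y = t.
Proof.
have bo := otimes_bilinear M N; have [s ->] := tensorP t.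
rewrite (lin_sum _ _ _ (tens_lift_linear bo)).
by apply: eq_bigr => p _; rewrite tens_liftE.
Qed.

(** Here the tensor summed over is itself a Sweedler sum, so linearity in the tensor is used, whence
    the bilinearity of [f]. *)
Lemma sw_comp M N M' N' W (f : M' -> N' -> W) (g : M -> N -> tensor M' N') t :
  bilinear_map f ->
  tens_lift f (tens_lift g t) = \sw_(x, y <- t) tens_lift f (g x y).
Proof. by move=> fb; rewrite sw_lin //; apply: tens_lift_linear. Qed.

Lemma linear_id V : linear (fun x : V => x). Proof. by []. Qed.

Lemma linear_fun V V' W (g : {linear V' -> W}) (f : V -> V') :
  linear f -> linear (fun x => g (f x)).
Proof. by move=> fl c x y; rewrite fl linearP. Qed.

Lemma linear_comp V V' W (g : V' -> W) (f : V -> V') :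
  linear g -> linear f -> linear (fun x => g (f x)).
Proof. by move=> gl fl c x y; rewrite fl gl. Qed.

Lemma linear_bil M N V W (B : M -> N -> W) (f : V -> M) n :
  bilinear_map B -> linear f -> linear (fun x => B (f x) n).
Proof. by move=> [Bl _] fl; apply: linear_comp (Bl n) fl. Qed.

Lemma linear_bir M N V W (B : M -> N -> W) (f : V -> N) m :
  bilinear_map B -> linear f -> linear (fun x => B m (f x)).
Proof. by move=> [_ Br] fl; apply: linear_comp (Br m) fl. Qed.

Lemma linear_swl M N V W (F : M -> N -> W) (f : V -> tensor M N) :
  bilinear_map F -> linear f -> linear (fun x => tens_lift F (f x)).
Proof. by move=> Fb; apply: linear_comp; apply: tens_lift_linear. Qed.

Lemma linear_swr M N V W (F : V -> M -> N -> W) t :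
  (forall m n, linear (fun x => F x m n)) -> linear (fun x => tens_lift (F x) t).
Proof.
move=> Fl c x y; have [s sE] := sw_sum t.
rewrite !sE scaler_sumr -big_split; apply: eq_bigr => p _ /=.
by rewrite Fl scalerDr !scalerA mulrC.
Qed.

Lemma linear_add V W (f g : V -> W) :
  linear f -> linear g -> linear (fun x => f x + g x).
Proof. by move=> fl gl c x y; rewrite fl gl scalerDr addrACA. Qed.

Lemma linear_opp V W (f : V -> W) : linear f -> linear (fun x => - f x).
Proof. by move=> fl c x y; rewrite fl opprD scalerN. Qed.

Lemma linear_scale V W (f : V -> W) a : linear f -> linear (fun x => a *: f x).
Proof. by move=> fl c x y; rewrite fl scalerDr !scalerA mulrC. Qed.

Lemma linear_scalel V W (f : V -> C^o) (w : W) :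
  linear f -> linear (fun x => (f x : C) *: w).
Proof. by move=> fl c x y; rewrite fl scalerDl scalerA. Qed.

Lemma mul_bilinear (A : algType C) : bilinear_map ( *%R : A -> A -> A).
Proof.
by split=> a c x y; [rewrite mulrDl scalerAl | rewrite mulrDr scalerAr].
Qed.

End TensorSums.

Definition trilinear_map (C : fieldType) (L M N W : lmodType C)
    (f : L -> M -> N -> W) :=
  [/\ forall m n, linear (fun l => f l m n), forall l n, linear (fun m => f l m n)
    & forall l m, linear (fun n => f l m n)].

Section Trilinear.
Variables (C : fieldType) (L M N V W : lmodType C) (T : L -> M -> N -> W).

Lemma linear_tri1 (f : V -> L) m n :
  trilinear_map T -> linear f -> linear (fun x => T (f x) m n).
Proof. by case=> Tl _ _ fl; apply: linear_comp (Tl m n) fl. Qed.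

Lemma linear_tri2 (f : V -> M) l n :
  trilinear_map T -> linear f -> linear (fun x => T l (f x) n).
Proof. by case=> _ Tm _ fl; apply: linear_comp (Tm l n) fl. Qed.

Lemma linear_tri3 (f : V -> N) l m :
  trilinear_map T -> linear f -> linear (fun x => T l m (f x)).
Proof. by case=> _ _ Tn fl; apply: linear_comp (Tn l m) fl. Qed.

End Trilinear.

(* Solves linearity goals by recursion on the body of the function; linear maps
   that are not canonically linear are found as hypotheses, whence the [Let]s
   recording the linearity of the coactions in the sections below. *)
Ltac lin :=
  cbn beta;
  lazymatch goal with
  | |- GRing.linear_for _ (fun x => _) => idtac
  | |- GRing.linear_for ?s ?f => change (GRing.linear_for s (fun x => f x))
  | |- _ => idtac
  end;
  lazymatch goal with
  | |- bilinear_map _ => first [assumption | split; intros ?; lin]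
  | |- trilinear_map _ => first [assumption | split; intros ? ?; lin]
  | |- forall _, _ => intros ?; lin
  | |- _ =>
    first
    [ assumption | exact: linear_id | exact: linearP
    | lazymatch goal with
      | H : bilinear_map ?B |- _ (fun x => ?B _ _) =>
        first [apply: (linear_bil _ H); lin | apply: (linear_bir _ H); lin]
      | H : trilinear_map ?B |- _ (fun x => ?B _ _ _) =>
        first [apply: (linear_tri1 _ _ H); lin | apply: (linear_tri2 _ _ H); lin
              | apply: (linear_tri3 _ _ H); lin]
      | |- _ (fun x => otimes _ _) =>
        first [apply: (linear_bil _ (otimes_bilinear _ _)); lin
              | apply: (linear_bir _ (otimes_bilinear _ _)); lin]
      | |- _ (fun x => otimesA _ _) =>
        first [apply: (linear_bil _ (otimesA_balanced _ _).1); lin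
              | apply: (linear_bir _ (otimesA_balanced _ _).1); lin]
      | |- _ (fun x => _ * _) =>
        first [apply: (linear_bil _ (mul_bilinear _)); lin
              | apply: (linear_bir _ (mul_bilinear _)); lin]
      | |- _ (fun x => lact _ _) =>
        first [apply: (linear_bil _ (lact_bilinear _)); lin
              | apply: (linear_bir _ (lact_bilinear _)); lin]
      | |- _ (fun x => ract _ _) =>
        first [apply: (linear_bil _ (ract_bilinear _)); lin
              | apply: (linear_bir _ (ract_bilinear _)); lin]
      | |- _ (fun x => tens_lift _ _) =>
        first [apply: linear_swr; lin | apply: linear_swl; lin]
      | |- _ (fun x => _ + _) => apply: linear_add; lin
      | |- _ (fun x => - _) => apply: linear_opp; lin
      | |- _ (fun x => _ *: _) =>
        first [apply: linear_scale; lin | apply: linear_scalel; lin]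
      | |- _ => first
        [ apply: linear_fun; lin
        | match goal with
          | H : GRing.linear_for _ ?f |- _ (fun x => ?f _) => apply: (linear_comp H); lin
          end ]
      end ]
  end.

#[local] Hint Extern 0 (bilinear_map _) => lin : core.
#[local] Hint Extern 0 (trilinear_map _) => lin : core.
#[local] Hint Extern 0 (GRing.linear_for _ _) => lin : core.

Lemma sw_scale (C : fieldType) (M N W : lmodType C) (f : M -> N -> W) c t :
  c *: tens_lift f t = \sw_(x, y <- t) (c *: f x y).
Proof. by rewrite (sw_lin (g := fun w => c *: w)). Qed.

Lemma sw_add (C : fieldType) (M N W : lmodType C) (f g : M -> N -> W) t :
  tens_lift f t + tens_lift g t = \sw_(x, y <- t) (f x y + g x y).
Proof.
have [s sE] := sw_sum t; rewrite !sE -big_split.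
by apply: eq_bigr => p _; rewrite scalerDr.
Qed.

Lemma sw_sub (C : fieldType) (M N W : lmodType C) (f g : M -> N -> W) t :
  tens_lift f t - tens_lift g t = \sw_(x, y <- t) (f x y - g x y).
Proof.
rewrite -[- _]scaleN1r sw_scale sw_add.
by apply: eq_sw => x y; rewrite scaleN1r.
Qed.

(** * Hopf algebras *)

Section HopfSweedler.
Variables (C : fieldType) (A : hopfAlgebra C) (W : lmodType C).
Implicit Types (a b : A).
Local Notation Delta := (comul A).
Local Notation S := (antipode A).

Lemma sw_map2 (X Y M N M' N' V : lmodType C) (f : X -> M -> M') (g : Y -> N -> N')
    (F : M' -> N' -> V) t u :
  bilinear_map F -> bilinear_map f -> bilinear_map g ->
  tens_lift F (tens_map2 f g t u) =
  \sw_(x, y <- t) \sw_(m, n <- u) F (f x m) (g y n).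
Proof.
move=> Fb fb gb; rewrite sw_comp //; apply: eq_sw => x y.
rewrite sw_comp //; apply: eq_sw => m n.
by rewrite tens_liftE.
Qed.

Lemma sw_comulM (F : A -> A -> W) a b :
  bilinear_map F ->
  \sw_(x, y <- Delta (a * b)) F x y =
  \sw_(a1, a2 <- Delta a) \sw_(b1, b2 <- Delta b) F (a1 * b1) (a2 * b2).
Proof. by move=> Fb; rewrite comulM sw_map2 //; apply: mul_bilinear. Qed.

Lemma sw_comul1 (F : A -> A -> W) :
  bilinear_map F -> \sw_(x, y <- Delta 1) F x y = F 1 1.
Proof. by move=> Fb; rewrite comul1 tens_liftE. Qed.

Lemma sw_coassoc (F : A -> A -> A -> W) a :
  trilinear_map F ->
  \sw_(x, a3 <- Delta a) \sw_(a1, a2 <- Delta x) F a1 a2 a3 =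
  \sw_(a1, y <- Delta a) \sw_(a2, a3 <- Delta y) F a1 a2 a3.
Proof.
(* Currying makes [F] a bilinear map on [A] and [A (x) A], which can be applied to both sides of
   [comulA]. *)
move=> Ft; pose G x t := \sw_(y, z <- t) F x y z.
have Gb : bilinear_map G by rewrite /G.
have := congr1 (fun t => tens_lift G t) (comulA a).
rewrite /tens_map /tens_assoc !sw_comp //.
under eq_sw => x y.
  rewrite tens_liftE // sw_comp //.
  under eq_sw => x1 x2 do rewrite tens_liftE // /G tens_liftE //.
  over.
by move=> ->; apply: eq_sw => x y; rewrite tens_liftE.
Qed.

Lemma sw_counitl (F : A -> W) a :
  linear F -> \sw_(a1, a2 <- Delta a) (counit A a1 : C) *: F a2 = F a.
Proof.
move=> Fl; rewrite -[in RHS](counitl a) (sw_lin _ _ Fl).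
by apply: eq_sw => x y; rewrite linZ.
Qed.

Lemma sw_counitr (F : A -> W) a :
  linear F -> \sw_(a1, a2 <- Delta a) (counit A a2 : C) *: F a1 = F a.
Proof.
move=> Fl; rewrite -[in RHS](counitr a) (sw_lin _ _ Fl).
by apply: eq_sw => x y; rewrite linZ.
Qed.

Lemma sw_antipodel (F : A -> W) a :
  linear F -> \sw_(a1, a2 <- Delta a) F (S a1 * a2) = (counit A a : C) *: F 1.
Proof. by move=> Fl; rewrite -linZ // -antipodel (sw_lin _ _ Fl). Qed.

Lemma sw_antipoder (F : A -> W) a :
  linear F -> \sw_(a1, a2 <- Delta a) F (a1 * S a2) = (counit A a : C) *: F 1.
Proof. by move=> Fl; rewrite -linZ // -antipoder (sw_lin _ _ Fl). Qed.

(** The four [sw_cancel] rules contract an adjacent pair [x S(y)] ([idS]) or [S(x) y] ([Sid]) at the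
    right or left end of a triple coproduct. The antipode axiom leaves a counit, which the counit
    axiom absorbs; the left versions rebracket first. *)
Lemma sw_cancel_idSr (F : A -> A -> W) a :
  bilinear_map F ->
  \sw_(a1, y <- Delta a) \sw_(a2, a3 <- Delta y) F a1 (a2 * S a3) = F a 1.
Proof.
move=> Fb; under eq_sw => x y do rewrite sw_antipoder //.
by rewrite (sw_counitr (F := F^~ 1)).
Qed.

Lemma sw_cancel_Sidr (F : A -> A -> W) a :
  bilinear_map F ->
  \sw_(a1, y <- Delta a) \sw_(a2, a3 <- Delta y) F a1 (S a2 * a3) = F a 1.
Proof.
move=> Fb; under eq_sw => x y do rewrite sw_antipodel //.
by rewrite (sw_counitr (F := F^~ 1)).
Qed.

Lemma sw_cancel_idSl (F : A -> A -> W) a :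
  bilinear_map F ->
  \sw_(a1, y <- Delta a) \sw_(a2, a3 <- Delta y) F (a1 * S a2) a3 = F 1 a.
Proof.
move=> Fb; rewrite -(sw_coassoc (F := fun x y z => F (x * S y) z)) //.
under eq_sw => x y do rewrite (sw_antipoder (F := F^~ y)) //.
by rewrite sw_counitl.
Qed.

Lemma sw_cancel_Sidl (F : A -> A -> W) a :
  bilinear_map F ->
  \sw_(a1, y <- Delta a) \sw_(a2, a3 <- Delta y) F (S a1 * a2) a3 = F 1 a.
Proof.
move=> Fb; rewrite -(sw_coassoc (F := fun x y z => F (S x * y) z)) //.
under eq_sw => x y do rewrite (sw_antipodel (F := F^~ y)) //.
by rewrite sw_counitl.
Qed.

End HopfSweedler.

(** * The antipode reverses products and coproducts *)

Section Antipode.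
Variables (C : fieldType) (A : hopfAlgebra C).
Implicit Types (a b : A).
Local Notation Delta := (comul A).
Local Notation S := (antipode A).

(* Both sides are convolution inverse to the multiplication of [A (x) A]. *)
Lemma antipodeM a b : S (a * b) = S b * S a.
Proof.
(* The convolution product of [S(ab)], [ab] and [S(b)S(a)]: contracting the last two factors gives
   the left side, contracting the first two the right side. *)
transitivity (\sw_(a1, x <- Delta a) \sw_(a2, a3 <- Delta x)
  \sw_(b1, y <- Delta b) \sw_(b2, b3 <- Delta y)
     S (a1 * b1) * (a2 * (b2 * S b3) * S a3)).
  under eq_sw => a1 x do under eq_sw => a2 a3 do
    (rewrite (sw_cancel_idSr (F := fun u v => S (a1 * u) * (a2 * v * S a3)));
      [rewrite mulr1|lin]).
  by rewrite (sw_cancel_idSr (F := fun u v => S (u * b) * v)) ?mulr1.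
under eq_sw => a1 x do under eq_sw => a2 a3 do
  rewrite -(sw_coassoc
    (F := fun u v w => S (a1 * u) * (a2 * (v * S w) * S a3))) //.
rewrite -(sw_coassoc (F := fun a1 a2 a3 => \sw_(y, b3 <- Delta b)
  \sw_(b1, b2 <- Delta y) S (a1 * b1) * (a2 * (b2 * S b3) * S a3))) //.
transitivity (\sw_(x, a3 <- Delta a) \sw_(y, b3 <- Delta b)
  (counit A (x * y) : C) *: (S b3 * S a3)).
  apply: eq_sw => x a3; rewrite sw_exchange; apply: eq_sw => y b3.
  rewrite sw_exchange.
  transitivity (\sw_(u, v <- Delta (x * y)) (S u * v) * (S b3 * S a3)).
    rewrite (sw_comulM (F := fun u v => S u * v * _)) //.
    rewrite sw_exchange; apply: eq_sw => a1 a2; apply: eq_sw => b1 b2.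
    by rewrite !mulrA.
  by rewrite (sw_antipodel (F := fun u => u * _)) ?mul1r.
transitivity (\sw_(x, a3 <- Delta a) (counit A x : C) *: (S b * S a3)).
  apply: eq_sw => x a3; rewrite -(sw_counitl (F := fun u => S u * S a3) b) //.
  rewrite sw_scale; apply: eq_sw => y b3.
  (* The counit takes values in the regular module [C^o], where multiplication is scaling. *)
  by rewrite rmorphM /= -[_ * _ : C^o]/(_ *: _ : C^o) -scalerA.
by rewrite (sw_counitl (F := fun u => _ * S u)).
Qed.

(* Both sides are convolution inverse to the coproduct. *)
Lemma sw_comul_antipode (W : lmodType C) (F : A -> A -> W) a :
  bilinear_map F ->
  \sw_(x, y <- Delta (S a)) F x y = \sw_(x, y <- Delta a) F (S y) (S x).
Proof.
(* [G] is the threefold convolution product of [Delta S], [Delta] and the flipped [(S (x) S) Delta],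
   tested against [F]. *)
move=> Fb; pose G a1 p q := \sw_(x, y <- Delta (S a1))
  \sw_(p1, p2 <- Delta p) \sw_(q1, q2 <- Delta q) F (x * p1 * S q2) (y * p2 * S q1).
have Gt : trilinear_map G by rewrite /G.
transitivity (\sw_(a1, r <- Delta a) \sw_(p, q <- Delta r) G a1 p q); last first.
  rewrite -(sw_coassoc _ Gt).
  transitivity (\sw_(u, q <- Delta a) (counit A u : C) *:
    \sw_(q1, q2 <- Delta q) F (S q2) (S q1)); last by rewrite sw_counitl.
  apply: eq_sw => u q.
  transitivity (\sw_(a1, p <- Delta u) \sw_(x, y <- Delta (S a1 * p))
     \sw_(q1, q2 <- Delta q) F (x * S q2) (y * S q1)).
    by apply: eq_sw => a1 p; rewrite [RHS]sw_comulM.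
  rewrite (sw_antipodel (F := fun v => \sw_(x, y <- Delta v)
     \sw_(q1, q2 <- Delta q) F (x * S q2) (y * S q1))) //.
  rewrite sw_comul1 //.
  by congr (_ *: _); apply: eq_sw => q1 q2; rewrite !mul1r.
transitivity (\sw_(a1, r <- Delta a) (counit A r : C) *:
    \sw_(x, y <- Delta (S a1)) F x y).
  by rewrite (sw_counitr (F := fun a1 => \sw_(x, y <- Delta (S a1)) F x y)).
apply: eq_sw => a1 r; rewrite sw_scale.
rewrite /G sw_exchange; apply: eq_sw => x y; apply/esym.
(* The contractions are nested: [p2] meets [S q1] first, and then [p1] meets the remaining
   antipode. *)
rewrite (sw_coassoc (F := fun p1 p2 q =>
  \sw_(q1, q2 <- Delta q) F (x * p1 * S q2) (y * p2 * S q1))) //.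
transitivity (\sw_(p1, r' <- Delta r) F (x * p1 * S r') y); last first.
  under eq_sw => p1 r' do rewrite -mulrA.
  by rewrite (sw_antipoder (F := fun u => F (x * u) y)) ?mulr1.
apply: eq_sw => p1 r'.
under eq_sw => p2 q do under eq_sw => q1 q2 do rewrite -(mulrA y).
rewrite (sw_cancel_idSl (F := fun u v => F (x * p1 * S v) (y * u))) ?mulr1 //.
Qed.

End Antipode.

(** * Coactions on a bicovariant calculus *)

Section CalcExt.
Variables (C : fieldType) (A : algType C) (E : calculus A) (W : lmodType C).
Local Notation d := (calc_d E).

Lemma calc_ind (f g : E -> W) :
  linear f -> linear g ->
  (forall a b, f (lact a (d b)) = g (lact a (d b))) -> f =1 g.
Proof.
move=> fl gl fg w; have [s ->] := calc_gen w.
by rewrite !lin_sum //; apply: eq_bigr.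
Qed.

Variable F : A -> A -> W.
Hypothesis Fb : bilinear_map F.
Hypothesis F0 : forall s : seq (A * A),
  \sum_(p <- s) lact p.1 (d p.2) = 0 -> \sum_(p <- s) F p.1 p.2 = 0.

Let FN a b : F (- a) b = - F a b.
Proof. exact: linN (Fb.1 b). Qed.

Lemma calc_ext_lact a b : calc_ext F (lact a (d b)) = F a b.
Proof. by have := calc_extE FN F0 [:: (a, b)]; rewrite !big_seq1. Qed.

Lemma calc_ext_linear : linear (calc_ext (E := E) F).
Proof.
move=> c u v; have [s ->] := calc_gen u; have [t ->] := calc_gen v.
have -> : c *: (\sum_(p <- s) lact p.1 (d p.2)) + \sum_(p <- t) lact p.1 (d p.2)
    = \sum_(p <- [seq (c *: p.1, p.2) | p <- s] ++ t) lact p.1 (d p.2).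
  rewrite big_cat big_map /= scaler_sumr; congr (_ + _).
  by apply: eq_bigr => p _; rewrite (linZ (f := fun x => lact x _)).
rewrite !calc_extE // big_cat big_map /= scaler_sumr; congr (_ + _).
by apply: eq_bigr => p _; rewrite (linZ (f := fun x => F x _)).
Qed.

End CalcExt.

Section Coactions.
Variables (C : fieldType) (A : hopfAlgebra C) (E : calculus A).
Hypothesis Ebicov : bicovariant_calculus E.
Local Notation d := (calc_d E).
Local Notation Delta := (comul A).
Local Notation S := (antipode A).

(** In Sweedler form the term is [a_1 b_1 (x) a_2 db_2], whose bilinearity [lin] can see. *)
Lemma lcoact_termE : lcoact_term E = fun a b =>
  \sw_(a1, a2 <- Delta a) \sw_(b1, b2 <- Delta b) otimes (a1 * b1) (lact a2 (d b2)).
Proof.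
apply/funext => a; apply/funext => b.
rewrite -[LHS]sw_otimes /lcoact_term sw_map2 //; apply: eq_sw => a1 a2.
by rewrite sw_comp //; apply: eq_sw => b1 b2; rewrite tens_liftE.
Qed.

Lemma rcoact_termE : rcoact_term E = fun a b =>
  \sw_(a1, a2 <- Delta a) \sw_(b1, b2 <- Delta b) otimes (lact a1 (d b1)) (a2 * b2).
Proof.
apply/funext => a; apply/funext => b.
rewrite -[LHS]sw_otimes /rcoact_term sw_map2 //; apply: eq_sw => a1 a2.
by rewrite sw_comp //; apply: eq_sw => b1 b2; rewrite tens_liftE.
Qed.

Let lterm_bilinear : bilinear_map (lcoact_term E).
Proof. by rewrite lcoact_termE. Qed.

Let rterm_bilinear : bilinear_map (rcoact_term E).
Proof. by rewrite rcoact_termE. Qed.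

Lemma lcoact_linear : linear (lcoact E).
Proof. by apply: calc_ext_linear => // s /Ebicov[]. Qed.

Lemma rcoact_linear : linear (rcoact E).
Proof. by apply: calc_ext_linear => // s /Ebicov[]. Qed.

Let lL := lcoact_linear.
Let rL := rcoact_linear.

Lemma sw_lcoact (W : lmodType C) (F : A -> E -> W) a b :
  bilinear_map F ->
  \sw_(x, m <- lcoact E (lact a (d b))) F x m =
  \sw_(a1, a2 <- Delta a) \sw_(b1, b2 <- Delta b) F (a1 * b1) (lact a2 (d b2)).
Proof.
move=> Fb; rewrite /lcoact calc_ext_lact //; last by move=> s /Ebicov[].
rewrite lcoact_termE sw_comp //; apply: eq_sw => a1 a2.
by rewrite sw_comp //; apply: eq_sw => b1 b2; rewrite tens_liftE.
Qed.

Lemma sw_rcoact (W : lmodType C) (F : E -> A -> W) a b :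
  bilinear_map F ->
  \sw_(m, x <- rcoact E (lact a (d b))) F m x =
  \sw_(a1, a2 <- Delta a) \sw_(b1, b2 <- Delta b) F (lact a1 (d b1)) (a2 * b2).
Proof.
move=> Fb; rewrite /rcoact calc_ext_lact //; last by move=> s /Ebicov[].
rewrite rcoact_termE sw_comp //; apply: eq_sw => a1 a2.
by rewrite sw_comp //; apply: eq_sw => b1 b2; rewrite tens_liftE.
Qed.

Lemma sw_lcoact_lact (W : lmodType C) (F : A -> E -> W) c m :
  bilinear_map F ->
  \sw_(x, n <- lcoact E (lact c m)) F x n =
  \sw_(c1, c2 <- Delta c) \sw_(x, n <- lcoact E m) F (c1 * x) (lact c2 n).
Proof.
move=> Fb; move: m; apply: calc_ind => // a b.
rewrite -lactM sw_lcoact // sw_comulM //; apply: eq_sw => c1 c2.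
rewrite sw_lcoact //; apply: eq_sw => a1 a2; apply: eq_sw => b1 b2.
by rewrite -lactM mulrA.
Qed.

Lemma sw_rcoact_lact (W : lmodType C) (F : E -> A -> W) c m :
  bilinear_map F ->
  \sw_(n, x <- rcoact E (lact c m)) F n x =
  \sw_(c1, c2 <- Delta c) \sw_(n, x <- rcoact E m) F (lact c1 n) (c2 * x).
Proof.
move=> Fb; move: m; apply: calc_ind => // a b.
rewrite -lactM sw_rcoact // sw_comulM //; apply: eq_sw => c1 c2.
rewrite sw_rcoact //; apply: eq_sw => a1 a2; apply: eq_sw => b1 b2.
by rewrite -lactM mulrA.
Qed.

(** The Leibniz rule solved for the right action: it writes [(a db) c] in the generators [x dy], so
    right-module properties can be checked on generators too. *)
Lemma ract_lact_d a b c :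
  ract (lact a (d b)) c = lact a (d (b * c)) - lact (a * b) (d c).
Proof.
rewrite calc_leibniz (linD (f := lact a)) // lactM lractA.
by rewrite addrK.
Qed.

Lemma sw_lcoact_ract (W : lmodType C) (F : A -> E -> W) m c :
  bilinear_map F ->
  \sw_(x, n <- lcoact E (ract m c)) F x n =
  \sw_(x, n <- lcoact E m) \sw_(c1, c2 <- Delta c) F (x * c1) (ract n c2).
Proof.
move=> Fb; move: m; apply: calc_ind => // a b.
rewrite ract_lact_d (linB (f := fun m => tens_lift F (lcoact E m))) //.
rewrite !sw_lcoact // [X in _ - X]sw_comulM // sw_sub; apply: eq_sw => a1 a2.
rewrite sw_comulM // sw_sub; apply: eq_sw => b1 b2.
rewrite sw_sub; apply: eq_sw => c1 c2.
by rewrite ract_lact_d (linB (f := F _)) // !mulrA.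
Qed.

Lemma sw_rcoact_ract (W : lmodType C) (F : E -> A -> W) m c :
  bilinear_map F ->
  \sw_(n, x <- rcoact E (ract m c)) F n x =
  \sw_(n, x <- rcoact E m) \sw_(c1, c2 <- Delta c) F (ract n c1) (x * c2).
Proof.
move=> Fb; move: m; apply: calc_ind => // a b.
rewrite ract_lact_d (linB (f := fun m => tens_lift F (rcoact E m))) //.
rewrite !sw_rcoact // [X in _ - X]sw_comulM // sw_sub; apply: eq_sw => a1 a2.
rewrite sw_comulM // sw_sub; apply: eq_sw => b1 b2.
rewrite sw_sub; apply: eq_sw => c1 c2.
by rewrite ract_lact_d (linB (f := F^~ _)) // !mulrA.
Qed.

(** On [a db] both sides become [a_1 db_1 (x) a_2 b_2 (x) a_3 b_3], by coassociativity for [a] and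
    for [b]. *)
Lemma sw_rcoact_coassoc (W : lmodType C) (F : E -> A -> A -> W) m :
  trilinear_map F ->
  \sw_(n, z <- rcoact E m) \sw_(n', y <- rcoact E n) F n' y z =
  \sw_(n, x <- rcoact E m) \sw_(y, z <- Delta x) F n y z.
Proof.
move=> Ft; move: m; apply: calc_ind => // a b; rewrite !sw_rcoact //.
transitivity (\sw_(x, a3 <- Delta a) \sw_(a1, a2 <- Delta x)
  \sw_(y, b3 <- Delta b) \sw_(b1, b2 <- Delta y)
     F (lact a1 (d b1)) (a2 * b2) (a3 * b3)).
  apply: eq_sw => x a3; rewrite [RHS]sw_exchange; apply: eq_sw => y b3.
  by rewrite sw_rcoact.
rewrite [LHS]sw_coassoc //; apply: eq_sw => a1 x.
under eq_sw => a2 a3 do rewrite sw_coassoc //.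
by rewrite sw_exchange; apply: eq_sw => b1 y; rewrite sw_comulM.
Qed.

Lemma sw_rcoact_counit m :
  \sw_(n, x <- rcoact E m) (counit A x : C) *: n = m.
Proof.
move: m; apply: calc_ind => // a b; rewrite sw_rcoact //.
rewrite -[RHS](sw_counitr (F := fun x => lact x (d b))) //; apply: eq_sw => a1 a2.
rewrite -(sw_counitr (F := fun x => lact a1 (d x)) b) // sw_scale.
by apply: eq_sw => b1 b2; rewrite rmorphM scalerA.
Qed.

(** The two coactions commute because both orders send [a db] to
    [a_1 b_1 (x) a_2 db_2 (x) a_3 b_3]. *)
Lemma sw_lcoact_rcoact (W : lmodType C) (F : A -> E -> A -> W) m :
  trilinear_map F ->
  \sw_(x, n <- lcoact E m) \sw_(n', y <- rcoact E n) F x n' y =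
  \sw_(n, y <- rcoact E m) \sw_(x, n' <- lcoact E n) F x n' y.
Proof.
move=> Ft; move: m; apply: calc_ind => // a b; rewrite sw_lcoact // sw_rcoact //.
transitivity (\sw_(a1, x <- Delta a) \sw_(a2, a3 <- Delta x)
  \sw_(b1, y <- Delta b) \sw_(b2, b3 <- Delta y)
     F (a1 * b1) (lact a2 (d b2)) (a3 * b3)).
  apply: eq_sw => a1 x; rewrite [RHS]sw_exchange; apply: eq_sw => b1 y.
  by rewrite sw_rcoact.
rewrite -[LHS]sw_coassoc //; apply: eq_sw => x a3.
under eq_sw => a1 a2 do rewrite -sw_coassoc //.
by rewrite sw_exchange; apply: eq_sw => b1 y; rewrite sw_lcoact.
Qed.

(** * The tensor product over [A] and its diagonal coactions *)

Lemma tens_balance (M N : bimodule A) (m : M) a (n : N) :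
  otimesA (ract m a) n = otimesA m (lact a n).
Proof. exact: (otimesA_balanced M N).2. Qed.

Lemma tens_lact (M N : bimodule A) a (m : M) (n : N) :
  lact a (otimesA m n : tensor_bimod M N) = otimesA (lact a m) n.
Proof.
apply: tensA_liftE; split=> [|k b l]; first by [].
by rewrite -lractA tens_balance.
Qed.

Lemma tens_ract (M N : bimodule A) (m : M) (n : N) a :
  ract (otimesA m n : tensor_bimod M N) a = otimesA m (ract n a).
Proof.
apply: tensA_liftE; split=> [|k b l]; first by [].
by rewrite lractA tens_balance.
Qed.

Lemma tens_ext (M N : bimodule A) (W : lmodType C) (f g : tensor_bimod M N -> W) :
  linear f -> linear g ->
  (forall m n, f (otimesA m n) = g (otimesA m n)) -> f =1 g.
Proof.
move=> fl gl fg t; have [s ->] := tensorAP t.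
by rewrite !lin_sum //; apply: eq_bigr.
Qed.

(** Bimodule covariance inserts [Delta a] between the two coactions on either side; associativity of
    [A] matches the first legs and balancing over [A] the second. *)
Let lcoact2_balanced : balanced (fun m n =>
  tens_map2 *%R (@otimesA C A E E) (lcoact E m) (lcoact E n)).
Proof.
split=> [|m a n]; first by rewrite /tens_map2 /tens_map.
rewrite /tens_map2 /tens_map sw_lcoact_ract //; apply: eq_sw => x m'.
rewrite sw_lcoact_lact //; apply: eq_sw => a1 a2; apply: eq_sw => y n'.
by rewrite mulrA tens_balance.
Qed.

Let rcoact2_balanced : balanced (fun m n =>
  tens_map2 (@otimesA C A E E) *%R (rcoact E m) (rcoact E n)).
Proof.
split=> [|m a n]; first by rewrite /tens_map2 /tens_map.
rewrite /tens_map2 /tens_map sw_rcoact_ract //; apply: eq_sw => m' x.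
rewrite sw_rcoact_lact //; apply: eq_sw => a1 a2; apply: eq_sw => n' y.
by rewrite mulrA tens_balance.
Qed.

Lemma lcoact2_linear : linear (lcoact2 E).
Proof. exact: tensA_lift_linear. Qed.

Lemma rcoact2_linear : linear (rcoact2 E).
Proof. exact: tensA_lift_linear. Qed.

Let l2L := lcoact2_linear.
Let r2L := rcoact2_linear.

Lemma sw_lcoact2 (W : lmodType C) (F : A -> tensor_bimod E E -> W) m n :
  bilinear_map F ->
  \sw_(x, t <- lcoact2 E (otimesA m n)) F x t =
  \sw_(x, m' <- lcoact E m) \sw_(y, n' <- lcoact E n) F (x * y) (otimesA m' n').
Proof. by move=> Fb; rewrite /lcoact2 /diag_lcoact tensA_liftE // sw_map2. Qed.

Lemma sw_rcoact2 (W : lmodType C) (F : tensor_bimod E E -> A -> W) m n :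
  bilinear_map F ->
  \sw_(t, x <- rcoact2 E (otimesA m n)) F t x =
  \sw_(m', x <- rcoact E m) \sw_(n', y <- rcoact E n) F (otimesA m' n') (x * y).
Proof. by move=> Fb; rewrite /rcoact2 /diag_rcoact tensA_liftE // sw_map2. Qed.

Lemma sw_lcoact2_lact (W : lmodType C) (F : A -> tensor_bimod E E -> W) a t :
  bilinear_map F ->
  \sw_(x, u <- lcoact2 E (lact a t)) F x u =
  \sw_(a1, a2 <- Delta a) \sw_(x, u <- lcoact2 E t) F (a1 * x) (lact a2 u).
Proof.
move=> Fb; move: t; apply: tens_ext => // m n.
rewrite tens_lact sw_lcoact2 // sw_lcoact_lact //; apply: eq_sw => a1 a2.
rewrite sw_lcoact2 //; apply: eq_sw => x m'; apply: eq_sw => y n'.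
by rewrite tens_lact mulrA.
Qed.

Lemma sw_rcoact2_lact (W : lmodType C) (F : tensor_bimod E E -> A -> W) a t :
  bilinear_map F ->
  \sw_(u, x <- rcoact2 E (lact a t)) F u x =
  \sw_(a1, a2 <- Delta a) \sw_(u, x <- rcoact2 E t) F (lact a1 u) (a2 * x).
Proof.
move=> Fb; move: t; apply: tens_ext => // m n.
rewrite tens_lact sw_rcoact2 // sw_rcoact_lact //; apply: eq_sw => a1 a2.
rewrite sw_rcoact2 //; apply: eq_sw => x m'; apply: eq_sw => y n'.
by rewrite tens_lact mulrA.
Qed.

Lemma sw_lcoact2_ract (W : lmodType C) (F : A -> tensor_bimod E E -> W) t a :
  bilinear_map F ->
  \sw_(x, u <- lcoact2 E (ract t a)) F x u =
  \sw_(x, u <- lcoact2 E t) \sw_(a1, a2 <- Delta a) F (x * a1) (ract u a2).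
Proof.
move=> Fb; move: t; apply: tens_ext => // m n.
rewrite tens_ract !sw_lcoact2 //; apply: eq_sw => x m'.
rewrite sw_lcoact_ract //; apply: eq_sw => y n'; apply: eq_sw => a1 a2.
by rewrite tens_ract mulrA.
Qed.

Lemma sw_rcoact2_ract (W : lmodType C) (F : tensor_bimod E E -> A -> W) t a :
  bilinear_map F ->
  \sw_(u, x <- rcoact2 E (ract t a)) F u x =
  \sw_(u, x <- rcoact2 E t) \sw_(a1, a2 <- Delta a) F (ract u a1) (x * a2).
Proof.
move=> Fb; move: t; apply: tens_ext => // m n.
rewrite tens_ract !sw_rcoact2 //; apply: eq_sw => x m'.
rewrite sw_rcoact_ract //; apply: eq_sw => y n'; apply: eq_sw => a1 a2.
by rewrite tens_ract mulrA.
Qed.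

Lemma sw_lcoact_d (W : lmodType C) (F : A -> E -> W) b :
  bilinear_map F ->
  \sw_(x, m <- lcoact E (d b)) F x m = \sw_(b1, b2 <- Delta b) F b1 (d b2).
Proof.
move=> Fb; rewrite -[d b]lact1 sw_lcoact // sw_comul1 //.
by apply: eq_sw => b1 b2; rewrite mul1r lact1.
Qed.

Lemma sw_rcoact_d (W : lmodType C) (F : E -> A -> W) b :
  bilinear_map F ->
  \sw_(m, x <- rcoact E (d b)) F m x = \sw_(b1, b2 <- Delta b) F (d b1) b2.
Proof.
move=> Fb; rewrite -[d b]lact1 sw_rcoact // sw_comul1 //.
by apply: eq_sw => b1 b2; rewrite mul1r lact1.
Qed.

(** The quantum Maurer-Cartan form of [a]; [rinv_form] is its right-handed mirror image. *)
Definition linv_form (a : A) : E := \sw_(a1, a2 <- Delta a) lact (S a1) (d a2).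
Definition rinv_form (a : A) : E := \sw_(a1, a2 <- Delta a) ract (d a1) (S a2).
Local Notation om := linv_form.
Local Notation et := rinv_form.

Lemma linv_form_linear : linear om. Proof. by rewrite /linv_form. Qed.
Lemma rinv_form_linear : linear et. Proof. by rewrite /rinv_form. Qed.
Let omL := linv_form_linear.
Let etL := rinv_form_linear.

(** As [Delta S] is flipped, the coaction gives [S(a_2) a_3 (x) S(a_1) da_4], and the inner pair
    cancels. *)
Lemma sw_lcoact_linv_form (W : lmodType C) (F : A -> E -> W) a :
  bilinear_map F -> \sw_(x, n <- lcoact E (om a)) F x n = F 1 (om a).
Proof.
move=> Fb; rewrite /linv_form (sw_lin (g := fun m => tens_lift F (lcoact E m))) //.
transitivity (\sw_(x, a2 <- Delta a) \sw_(u, v <- Delta x)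
    \sw_(b1, b2 <- Delta a2) F (S v * b1) (lact (S u) (d b2))).
  by apply: eq_sw => a1 a2; rewrite sw_lcoact // sw_comul_antipode.
rewrite sw_coassoc // (sw_lin (g := F 1)) //; apply: eq_sw => u r.
by rewrite (sw_cancel_Sidl (F := fun x y => F x (lact (S u) (d y)))).
Qed.

Lemma sw_rcoact_rinv_form (W : lmodType C) (F : E -> A -> W) a :
  bilinear_map F -> \sw_(n, x <- rcoact E (et a)) F n x = F (et a) 1.
Proof.
move=> Fb; rewrite /rinv_form (sw_lin (g := fun m => tens_lift F (rcoact E m))) //.
transitivity (\sw_(x, a2 <- Delta a) \sw_(b1, b2 <- Delta x)
    \sw_(u, v <- Delta a2) F (ract (d b1) (S v)) (b2 * S u)).
  apply: eq_sw => a1 a2; rewrite sw_rcoact_ract // sw_rcoact_d //.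
  by apply: eq_sw => b1 b2; rewrite sw_comul_antipode.
rewrite sw_coassoc // (sw_lin (g := F^~ 1)) //; apply: eq_sw => b1 r.
by rewrite (sw_cancel_idSl (F := fun x y => F (ract (d b1) (S y)) x)).
Qed.

(** [rinv_form] carries the left adjoint coaction of [A], [b |-> b_1 S(b_3) (x) b_2], to the left
    coaction of [E]. The next lemma is the mirror image; together they give the coactions on the
    generators used for [sigma]. *)
Lemma sw_lcoact_rinv_form (W : lmodType C) (F : A -> E -> W) b :
  bilinear_map F ->
  \sw_(x, n <- lcoact E (et b)) F x n =
  \sw_(b1, r <- Delta b) \sw_(b2, b3 <- Delta r) F (b1 * S b3) (et b2).
Proof.
move=> Fb; rewrite /rinv_form (sw_lin (g := fun m => tens_lift F (lcoact E m))) //.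
transitivity (\sw_(x, a2 <- Delta b) \sw_(b1, b2 <- Delta x)
    \sw_(u, v <- Delta a2) F (b1 * S v) (ract (d b2) (S u))).
  apply: eq_sw => a1 a2; rewrite sw_lcoact_ract // sw_lcoact_d //.
  by apply: eq_sw => b1 b2; rewrite sw_comul_antipode.
rewrite [LHS]sw_coassoc //; apply: eq_sw => b1 r; rewrite -[LHS]sw_coassoc //.
by apply: eq_sw => b2 b3; rewrite (sw_lin (g := F _)).
Qed.

Lemma sw_rcoact_linv_form (W : lmodType C) (F : E -> A -> W) a :
  bilinear_map F ->
  \sw_(n, x <- rcoact E (om a)) F n x =
  \sw_(a1, r <- Delta a) \sw_(a2, a3 <- Delta r) F (om a2) (S a1 * a3).
Proof.
move=> Fb; rewrite /linv_form (sw_lin (g := fun m => tens_lift F (rcoact E m))) //.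
transitivity (\sw_(x, a2 <- Delta a) \sw_(u, v <- Delta x)
    \sw_(b1, b2 <- Delta a2) F (lact (S v) (d b1)) (S u * b2)).
  by apply: eq_sw => a1 a2; rewrite sw_rcoact // sw_comul_antipode.
rewrite [LHS]sw_coassoc //; apply: eq_sw => b1 r; rewrite -[LHS]sw_coassoc //.
by apply: eq_sw => b2 b3; rewrite (sw_lin (g := F^~ _)).
Qed.

(** Insert [a_1 S(a_2)] in front of [da_3]. *)
Lemma d_linv_form a : d a = \sw_(a1, a2 <- Delta a) lact a1 (om a2).
Proof.
rewrite /linv_form; transitivity (\sw_(a1, r <- Delta a) \sw_(a2, a3 <- Delta r)
    lact (a1 * S a2) (d a3)).
  by rewrite (sw_cancel_idSl (F := fun x y => lact x (d y))) // lact1.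
apply: eq_sw => a1 r; rewrite (sw_lin (g := lact a1)) //.
by apply: eq_sw => a2 a3; rewrite lactM.
Qed.

Lemma d_rinv_form a : d a = \sw_(a1, a2 <- Delta a) ract (et a1) a2.
Proof.
rewrite /rinv_form; transitivity (\sw_(r, a3 <- Delta a) \sw_(a1, a2 <- Delta r)
    ract (d a1) (S a2 * a3)).
  rewrite [RHS]sw_coassoc //.
  by rewrite (sw_cancel_Sidr (F := fun x y => ract (d x) y)) // ract1.
apply: eq_sw => r a3; rewrite (sw_lin (g := fun m => ract m a3)) //.
by apply: eq_sw => a1 a2; rewrite ractM.
Qed.

Lemma calc_ind_linv_form (W : lmodType C) (f g : E -> W) :
  linear f -> linear g ->
  (forall c a, f (lact c (om a)) = g (lact c (om a))) -> f =1 g.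
Proof.
move=> fl gl fg; apply: calc_ind => // c b; rewrite d_linv_form.
rewrite (sw_lin (g := lact c)) // !(sw_lin (g := f), sw_lin (g := g)) //.
by apply: eq_sw => b1 b2; rewrite -lactM.
Qed.

Lemma calc_ind_rinv_form (W : lmodType C) (f g : E -> W) :
  linear f -> linear g ->
  (forall a c, f (ract (et a) c) = g (ract (et a) c)) -> f =1 g.
Proof.
move=> fl gl fg; have fgd a c : f (ract (d a) c) = g (ract (d a) c).
  rewrite d_rinv_form (sw_lin (g := fun m => ract m c)) //.
  rewrite !(sw_lin (g := f), sw_lin (g := g)) //.
  by apply: eq_sw => a1 a2; rewrite -ractM.
apply: calc_ind => // a b.
(* By the Leibniz rule the elements [(dx) c] span [E] as well. *)
have -> : lact a (d b) = ract (d (a * b)) 1 - ract (d a) b.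
  by rewrite ract1 calc_leibniz addrAC subrr add0r.
by rewrite (linB (f := f)) // (linB (f := g)) // !fgd.
Qed.

Local Notation "m (x) n" := (otimesA m n : tensor_bimod E E) (at level 40).

(** The elements [om a (x) et b], on which [sigma] is the flip, generate [E (x)_A E] as a
    bimodule. *)
Lemma tens_ind_linv_rinv (W : lmodType C) (f g : tensor_bimod E E -> W) :
  linear f -> linear g ->
  (forall c a b e,
     f (lact c (ract (om a (x) et b) e)) = g (lact c (ract (om a (x) et b) e))) ->
  f =1 g.
Proof.
move=> fl gl fg; apply: tens_ext => // m n; move: m; apply: calc_ind_linv_form => // c a.
move: n; apply: calc_ind_rinv_form => // b e.
by have := fg c a b e; rewrite tens_ract tens_lact.
Qed.

(** Left-invariant elements generate [E (x)_A E] as a left module: the coefficient of the second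
    factor is moved across the tensor sign and absorbed into the first factor before that is
    expanded. *)
Lemma tens_ind_linv (W : lmodType C) (f g : tensor_bimod E E -> W) :
  linear f -> linear g ->
  (forall c a b, f (lact c (om a (x) om b)) = g (lact c (om a (x) om b))) -> f =1 g.
Proof.
move=> fl gl fg; apply: tens_ext => // m n; move: n; apply: calc_ind_linv_form => // c a.
rewrite -tens_balance; move: (ract m c) => {}m; move: m.
apply: calc_ind_linv_form => // e b.
by have := fg e b a; rewrite tens_lact.
Qed.

End Coactions.

(** * The canonical braiding *)

Section Covariant.
Variables (C : fieldType) (A : hopfAlgebra C) (M N W : lmodType C) (T T' : M -> N).

Lemma left_covariant_sw (dM : M -> tensor A M) (dN : N -> tensor A N)
    (F : A -> N -> W) m :
  left_covariant dM dN T -> bilinear_map F ->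
  \sw_(x, n <- dM m) F x (T n) = \sw_(x, n <- dN (T m)) F x n.
Proof.
move=> Tc Fb; rewrite -Tc /tens_map sw_comp //.
by apply: eq_sw => x n; rewrite tens_liftE.
Qed.

Lemma right_covariant_sw (rM : M -> tensor M A) (rN : N -> tensor N A)
    (F : N -> A -> W) m :
  right_covariant rM rN T -> bilinear_map F ->
  \sw_(n, x <- rM m) F (T n) x = \sw_(n, x <- rN (T m)) F n x.
Proof.
move=> Tc Fb; rewrite -Tc /tens_map sw_comp //.
by apply: eq_sw => n x; rewrite tens_liftE.
Qed.

(** Covariant maps are closed under scaling, differences and, below, composition. This covers
    polynomials in [sigma] and the final connection. *)
Lemma left_covariant_scale (dM : M -> tensor A M) (dN : N -> tensor A N) c :
  linear dN -> left_covariant dM dN T ->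
  left_covariant dM dN (fun m => c *: T m).
Proof.
move=> dl Tc m; rewrite linZ // -Tc /tens_map sw_scale.
by apply: eq_sw => x n; rewrite (linZ (f := otimes _)).
Qed.

Lemma right_covariant_scale (rM : M -> tensor M A) (rN : N -> tensor N A) c :
  linear rN -> right_covariant rM rN T ->
  right_covariant rM rN (fun m => c *: T m).
Proof.
move=> dl Tc m; rewrite linZ // -Tc /tens_map sw_scale.
by apply: eq_sw => n x; rewrite (linZ (f := fun u => otimes u x)).
Qed.

Lemma left_covariant_sub (dM : M -> tensor A M) (dN : N -> tensor A N) :
  linear dN -> left_covariant dM dN T -> left_covariant dM dN T' ->
  left_covariant dM dN (fun m => T m - T' m).
Proof.
move=> dl Tc T'c m; rewrite (linB (f := dN)) // -Tc -T'c /tens_map sw_sub.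
by apply: eq_sw => x n; rewrite (linB (f := otimes _)).
Qed.

Lemma right_covariant_sub (rM : M -> tensor M A) (rN : N -> tensor N A) :
  linear rN -> right_covariant rM rN T -> right_covariant rM rN T' ->
  right_covariant rM rN (fun m => T m - T' m).
Proof.
move=> dl Tc T'c m; rewrite (linB (f := rN)) // -Tc -T'c /tens_map sw_sub.
by apply: eq_sw => n x; rewrite (linB (f := fun u => otimes u x)).
Qed.

End Covariant.

Section CovariantComp.
Variables (C : fieldType) (A : hopfAlgebra C) (M N K : lmodType C).
Variables (T : M -> N) (T' : N -> K).
Hypothesis T'l : linear T'.

Lemma left_covariant_comp (dM : M -> tensor A M) (dN : N -> tensor A N)
    (dK : K -> tensor A K) :
  left_covariant dM dN T -> left_covariant dN dK T' ->
  left_covariant dM dK (fun m => T' (T m)).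
Proof.
move=> Tc T'c m; rewrite -T'c /tens_map -[RHS](left_covariant_sw m Tc) //.
Qed.

Lemma right_covariant_comp (rM : M -> tensor M A) (rN : N -> tensor N A)
    (rK : K -> tensor K A) :
  right_covariant rM rN T -> right_covariant rN rK T' ->
  right_covariant rM rK (fun m => T' (T m)).
Proof.
move=> Tc T'c m; rewrite -T'c /tens_map -[RHS](right_covariant_sw m Tc) //.
Qed.

End CovariantComp.

Section Braiding.
Variables (C : fieldType) (A : hopfAlgebra C) (E : calculus A).
Hypothesis Ebicov : bicovariant_calculus E.
Local Notation d := (calc_d E).
Local Notation Delta := (comul A).
Local Notation S := (antipode A).
Local Notation om := (linv_form E).
Local Notation et := (rinv_form E).
Local Notation "m (x) n" := (otimesA m n : tensor_bimod E E) (at level 40).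
Let lL := lcoact_linear Ebicov.
Let rL := rcoact_linear Ebicov.
Let l2L := lcoact2_linear Ebicov.
Let r2L := rcoact2_linear Ebicov.
Let omL := linv_form_linear E.
Let etL := rinv_form_linear E.

Variable sigma : {linear tensor_bimod E E -> tensor_bimod E E}.
Hypothesis sigma_braiding : canonical_braiding sigma.

Let sigma_l a t : sigma (lact a t) = lact a (sigma t).
Proof. by have [[]] := sigma_braiding. Qed.

Let sigma_r t a : sigma (ract t a) = ract (sigma t) a.
Proof. by have [[]] := sigma_braiding. Qed.

Lemma linv_form_left_invariant a : left_invariant (lcoact E) (om a).
Proof. by rewrite /left_invariant -[LHS]sw_otimes sw_lcoact_linv_form. Qed.

Lemma rinv_form_right_invariant a : right_invariant (rcoact E) (et a).
Proof. by rewrite /right_invariant -[LHS]sw_otimes sw_rcoact_rinv_form. Qed.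

Lemma linv_form_tens_left_invariant a b : left_invariant (lcoact2 E) (om a (x) om b).
Proof.
rewrite /left_invariant -[LHS]sw_otimes sw_lcoact2 // sw_lcoact_linv_form //.
by rewrite sw_lcoact_linv_form // mulr1.
Qed.

Lemma sigma_linv_rinv a b : sigma (om a (x) et b) = et b (x) om a.
Proof.
by have [_] := sigma_braiding; apply;
  [exact: linv_form_left_invariant | exact: rinv_form_right_invariant].
Qed.

Lemma sigma_dd a b : sigma (d a (x) d b) =
  \sw_(a1, a2 <- Delta a) \sw_(b1, b2 <- Delta b)
    (lact a1 (et b1) (x) ract (om a2) b2).
Proof.
rewrite d_linv_form d_rinv_form (sw_lin (g := fun m => sigma (m (x) _))) //.
apply: eq_sw => a1 a2; rewrite (sw_lin (g := fun m => sigma (_ (x) m))) //.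
apply: eq_sw => b1 b2.
by rewrite -tens_ract -tens_lact sigma_r sigma_l sigma_linv_rinv tens_lact tens_ract.
Qed.

(** The map [E -> E (x)_A E] that computes [sigma - 1] on [da (x) db] from [a db] alone. Written
    with coactions, it is well defined and linear on all of [E]. *)
Definition sigma_defect (m : E) : tensor_bimod E E :=
  (\sw_(n, x <- rcoact E m) (n (x) om x)) -
  \sw_(x, n <- lcoact E m) \sw_(x1, x2 <- Delta x) (d x1 (x) lact (S x2) n).

Lemma sigma_defect_linear : linear sigma_defect.
Proof. by rewrite /sigma_defect. Qed.

Lemma sigma_defectE a b :
  sigma_defect (lact a (d b)) = sigma (d a (x) d b) - d a (x) d b.
Proof.
pose X := \sw_(b1, b2 <- Delta b) (lact a (d b1) (x) om b2).
pose Y := \sw_(b1, b2 <- Delta b) (d (a * b1) (x) om b2).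
pose Z := \sw_(a1, a2 <- Delta a) \sw_(b1, b2 <- Delta b)
  (lact a1 (d b1) (x) om (a2 * b2)).
(* Write [db = b_1 om(b_2)] and use [(da) b_1 = d(a b_1) - a db_1]. *)
have dd : d a (x) d b = Y - X.
  rewrite [d b]d_linv_form (sw_lin (g := fun m => _ (x) m)) // sw_sub.
  apply: eq_sw => b1 b2; rewrite calc_leibniz -tens_balance.
  by rewrite (linD (f := fun m => m (x) om b2)) // addrK.
(* Expand [om(a_2) b_2] as [S(u) d(v b_2) - S(u) v db_2], where [Delta a_2 = u (x) v]. *)
have sdd : sigma (d a (x) d b) = Z - X.
  rewrite sigma_dd.
  transitivity (
    (\sw_(a1, a2 <- Delta a) \sw_(u, v <- Delta a2) \sw_(b1, b2 <- Delta b)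
      (lact a1 (et b1) (x) lact (S u) (d (v * b2)))) -
    \sw_(a1, a2 <- Delta a) \sw_(u, v <- Delta a2) \sw_(b1, b2 <- Delta b)
      (lact a1 (et b1) (x) lact (S u * v) (d b2))).
    rewrite sw_sub; apply: eq_sw => a1 a2; rewrite sw_sub.
    under [RHS]eq_sw => u v do rewrite sw_sub.
    rewrite [RHS]sw_exchange; apply: eq_sw => b1 b2.
    rewrite {1}/linv_form (sw_lin (g := fun m => _ (x) ract m b2)) //.
    apply: eq_sw => u v.
    by rewrite ract_lact_d (linB (f := fun m => _ (x) m)).
  congr (_ - _).
    (* The first sum is [Z]: the antipode [S(q)] in [et(b_1)] crosses the tensor sign and meets
       [S(u)], and [S(q) S(u) = S(uq)] completes [om(a_2 b_2)]. *)
    apply: eq_sw => a1 a2; rewrite sw_exchange.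
    transitivity (\sw_(y, b2 <- Delta b) \sw_(p, q <- Delta y)
      \sw_(u, v <- Delta a2) (lact a1 (d p) (x) lact (S (u * q)) (d (v * b2)))).
      apply: eq_sw => y b2; rewrite [RHS]sw_exchange; apply: eq_sw => u v.
      rewrite {1}/rinv_form (sw_lin (g := fun m => lact a1 m (x) _)) //.
      apply: eq_sw => p q.
      by rewrite -lractA tens_balance -lactM antipodeM.
    rewrite [LHS]sw_coassoc //; apply: eq_sw => p r.
    rewrite /linv_form sw_comulM // [in RHS]sw_exchange.
    rewrite [RHS](sw_lin (g := fun m => _ (x) m)) //; apply: eq_sw => q b2.
    by rewrite [RHS](sw_lin (g := fun m => _ (x) m)).
  (* The second sum is [X]: [S(u) v] cancels, and the antipode of [et(b_1)] crosses over to form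
     [om]. *)
  rewrite (sw_cancel_Sidr (F := fun x y => \sw_(b1, b2 <- Delta b)
      (lact x (et b1) (x) lact y (d b2)))) //.
  transitivity (\sw_(y, b2 <- Delta b) \sw_(p, q <- Delta y)
      (lact a (d p) (x) lact (S q) (d b2))).
    apply: eq_sw => y b2; rewrite lact1.
    rewrite {1}/rinv_form (sw_lin (g := fun m => lact a m (x) _)) //.
    by apply: eq_sw => p q; rewrite -lractA tens_balance.
  rewrite [LHS]sw_coassoc //; apply: eq_sw => p r.
  by rewrite (sw_lin (g := fun m => _ (x) m)).
(* [X] drops out of the difference; [Z] is the right-coaction term of [sigma_defect], and [Y]
   remains to be matched with the left-coaction term. *)
rewrite sdd dd opprB addrA subrK /sigma_defect; congr (_ - _).
  by rewrite sw_rcoact.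
rewrite sw_lcoact //.
(* In [S(a_2 b_2) a_3 = S(b_2) S(a_2) a_3] the factors from [a] cancel, leaving [Y]. *)
transitivity (\sw_(x, a3 <- Delta a) \sw_(a1, a2 <- Delta x)
  \sw_(y, b3 <- Delta b) \sw_(b1, b2 <- Delta y)
    (d (a1 * b1) (x) lact (S b2 * (S a2 * a3)) (d b3))).
  apply: eq_sw => x a3; rewrite [RHS]sw_exchange; apply: eq_sw => y b3.
  rewrite sw_comulM //; apply: eq_sw => a1 a2; apply: eq_sw => b1 b2.
  by rewrite -lactM antipodeM mulrA.
rewrite [LHS]sw_coassoc // (sw_cancel_Sidr (F := fun x z =>
  \sw_(y, b3 <- Delta b) \sw_(b1, b2 <- Delta y)
    (d (x * b1) (x) lact (S b2 * z) (d b3)))) //.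
rewrite [LHS]sw_coassoc //; apply: eq_sw => b1 r.
rewrite /linv_form (sw_lin (g := fun m => _ (x) m)) //.
by apply: eq_sw => b2 b3; rewrite mulr1.
Qed.

(** The difference of the two sides is [sigma_defect] of the vanishing sum. Stated before passing to
    the quotient, this serves both [ext_d] and its lift to [E (x)_A E]. *)
Lemma sigma_fixes_relations (s : seq (A * A)) :
  \sum_(p <- s) lact p.1 (d p.2) = 0 ->
  sigma (\sum_(p <- s) (d p.1 (x) d p.2)) = \sum_(p <- s) (d p.1 (x) d p.2).
Proof.
move=> s0; apply/eqP; rewrite -subr_eq0 -sumrN linear_sum -big_split /=.
rewrite -(eq_bigr _ (fun p _ => sigma_defectE p.1 p.2)).
by rewrite -lin_sum ?s0 ?lin0 //; exact: sigma_defect_linear.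
Qed.

(** On a generator [om a (x) et b] the first factor is invariant, so only [et b] contributes to the
    coaction, and it does so equally in either order of the factors. *)
Lemma sigma_left_covariant : left_covariant (lcoact2 E) (lcoact2 E) sigma.
Proof.
move=> t; rewrite -[RHS]sw_otimes; move: t.
apply: tens_ind_linv_rinv => // [|c a b e]; first by rewrite /tens_map.
rewrite /tens_map sigma_l sigma_r sigma_linv_rinv.
rewrite !sw_lcoact2_lact //; apply: eq_sw => c1 c2.
rewrite !sw_lcoact2_ract // !sw_lcoact2 // sw_lcoact_linv_form // !sw_lcoact_rinv_form //.
apply: eq_sw => b1 r; apply: eq_sw => b2 b3; rewrite sw_lcoact_linv_form //.
apply: eq_sw => e1 e2.
by rewrite mul1r mulr1 sigma_l sigma_r sigma_linv_rinv.
Qed.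

Lemma sigma_right_covariant : right_covariant (rcoact2 E) (rcoact2 E) sigma.
Proof.
move=> t; rewrite -[RHS]sw_otimes; move: t.
apply: tens_ind_linv_rinv => // [|c a b e]; first by rewrite /tens_map.
rewrite /tens_map sigma_l sigma_r sigma_linv_rinv.
rewrite !sw_rcoact2_lact //; apply: eq_sw => c1 c2.
rewrite !sw_rcoact2_ract // !sw_rcoact2 // sw_rcoact_rinv_form // !sw_rcoact_linv_form //.
apply: eq_sw => a1 r; apply: eq_sw => a2 a3; rewrite sw_rcoact_rinv_form //.
apply: eq_sw => e1 e2.
by rewrite mul1r mulr1 sigma_l sigma_r sigma_linv_rinv.
Qed.

(* For [s] the list of eigenvalues other than [1], the spectral projection of
   [sigma] onto its eigenspace of eigenvalue [1]. *)
Fixpoint spectral_proj (s : seq C) (t : tensor_bimod E E) : tensor_bimod E E :=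
  if s is l :: s' then
    (1 - l)^-1 *: (sigma (spectral_proj s' t) - l *: spectral_proj s' t)
  else t.

Lemma spectral_proj_linear s : linear (spectral_proj s).
Proof. by elim: s => [|l s IHs] //=. Qed.
Let pL := spectral_proj_linear.

Lemma spectral_proj_lact s a t :
  spectral_proj s (lact a t) = lact a (spectral_proj s t).
Proof.
elim: s => [|l s IHs] //; cbn [spectral_proj]; rewrite IHs sigma_l.
by rewrite (linZ (f := lact a)) // (linB (f := lact a)) // (linZ (f := lact a)).
Qed.

Lemma spectral_proj_ract s t a :
  spectral_proj s (ract t a) = ract (spectral_proj s t) a.
Proof.
elim: s => [|l s IHs] //; cbn [spectral_proj]; rewrite IHs sigma_r.
rewrite (linZ (f := fun t => ract t a)) // (linB (f := fun t => ract t a)) //.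
by rewrite (linZ (f := fun t => ract t a)).
Qed.

Lemma spectral_proj_left_covariant s :
  left_covariant (lcoact2 E) (lcoact2 E) (spectral_proj s).
Proof.
elim: s => [|l s IHs]; first by move=> t; apply: sw_otimes.
apply: left_covariant_scale => //; apply: left_covariant_sub => //.
  by apply: left_covariant_comp => //; apply: sigma_left_covariant.
exact: left_covariant_scale.
Qed.

Lemma spectral_proj_right_covariant s :
  right_covariant (rcoact2 E) (rcoact2 E) (spectral_proj s).
Proof.
elim: s => [|l s IHs]; first by move=> t; apply: sw_otimes.
apply: right_covariant_scale => //; apply: right_covariant_sub => //.
  by apply: right_covariant_comp => //; apply: sigma_right_covariant.
exact: right_covariant_scale.
Qed.

(** The scalar is the value at [l] of a Lagrange polynomial: it vanishes for [l] in [s] and, when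
    [1] is not in [s], equals [1] for [l = 1]. *)
Lemma spectral_proj_eigen s l v :
  sigma v = l *: v ->
  spectral_proj s v = (\prod_(m <- s) ((1 - m)^-1 * (l - m))) *: v.
Proof.
move=> vl; elim: s => [|m s IHs]; first by rewrite big_nil scale1r.
cbn [spectral_proj]; rewrite IHs (linZ (f := sigma)) // vl big_cons.
set p := \prod_(_ <- _) _; transitivity ((1 - m)^-1 *: (((l - m) * p) *: v)).
  by rewrite mulrBl scalerBl [l * p]mulrC !scalerA.
by rewrite scalerA mulrA.
Qed.

Lemma spectral_proj_fix s t :
  1 \notin s -> sigma t = t -> spectral_proj s t = t.
Proof.
move=> s1 st; rewrite (spectral_proj_eigen s (l := 1)) ?scale1r //.
rewrite big1_seq ?scale1r // => m /= ms; rewrite mulVf // subr_eq0.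
by apply: contraNneq s1 => ->.
Qed.

Lemma spectral_proj_kill s l v :
  l \in s -> sigma v = l *: v -> spectral_proj s v = 0.
Proof.
move=> ls vl; rewrite (spectral_proj_eigen s vl) (perm_big _ (perm_to_rem ls)) /=.
by rewrite big_cons subrr mulr0 mul0r scale0r.
Qed.

(** An eigenbasis is given only for the left-invariant elements; as [sigma] and [spectral_proj] are
    left [A]-linear and these elements generate, the identity extends to all of [E (x)_A E]. *)
Lemma diagonalisable_spectral_proj :
  diagonalisable_on (left_invariant (lcoact2 E)) sigma ->
  exists2 s, 1 \notin s & forall t, sigma (spectral_proj s t) = spectral_proj s t.
Proof.
move=> [n [v [[vinv vspan] _ /fin_all_exists[ev evE]]]].
(* The eigenvalues of the given basis, with [1] removed: basis vectors of eigenvalue [1] are fixed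
   by the projection, the others killed. *)
exists [seq l <- [seq ev i | i : 'I_n] | l != 1]; first by rewrite mem_filter eqxx.
set s := [seq _ <- _ | _]; apply: tens_ind_linv => //.
  by apply: linear_comp (spectral_proj_linear s).
move=> c a b; rewrite spectral_proj_lact sigma_l; congr (lact c _).
have [k ->] := vspan _ (linv_form_tens_left_invariant a b).
rewrite !lin_sum //; apply: eq_bigr => i _.
rewrite (linZ _ _ (pL s)) (linZ (f := sigma)) //; congr (_ *: _).
have [ei|ei] := eqVneq (ev i) 1.
  have vi : sigma (v i) = v i by rewrite evE ei scale1r.
  by rewrite spectral_proj_fix // mem_filter eqxx.
rewrite (spectral_proj_kill _ (evE i)) ?lin0 // mem_filter ei map_f //.
by rewrite mem_enum.
Qed.

End Braiding.

(** * Connections *)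

Section Grassmann.
Variables (C : fieldType) (A : hopfAlgebra C) (E : calculus A).
Hypothesis Ebicov : bicovariant_calculus E.
Local Notation d := (calc_d E).
Local Notation Delta := (comul A).
Local Notation S := (antipode A).
Local Notation "m (x) n" := (otimesA m n : tensor_bimod E E) (at level 40).
Let lL := lcoact_linear Ebicov.
Let rL := rcoact_linear Ebicov.
Let l2L := lcoact2_linear Ebicov.
Let r2L := rcoact2_linear Ebicov.

(* [m_(0) S(m_(1))] is right-invariant and [m = m_(0) S(m_(1)) m_(2)]. *)
Definition grassmann (m : E) : tensor_bimod E E :=
  \sw_(n, x <- rcoact E m) \sw_(x1, x2 <- Delta x) (ract n (S x1) (x) d x2).

Lemma grassmann_linear : linear grassmann.
Proof. by rewrite /grassmann. Qed.
Let gL := grassmann_linear.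

Lemma grassmann_connection : right_connection grassmann.
Proof.
split=> // m a; rewrite /grassmann sw_rcoact_ract //.
rewrite (sw_lin (g := fun t => ract t a)) //.
(* Expanding [m] by the counit makes every term a sum over the same coaction of [m]. *)
rewrite -[in otimesA m _](sw_rcoact_counit Ebicov m).
rewrite (sw_lin (g := fun m => m (x) d a)) // sw_add; apply: eq_sw => n x.
transitivity (\sw_(a1, r <- Delta a) \sw_(a2, a3 <- Delta r) \sw_(x1, x2 <- Delta x)
    (ract n (a1 * S a2 * S x1) (x) d (x2 * a3))).
  apply: eq_sw => a1 r; rewrite sw_comulM // sw_exchange.
  apply: eq_sw => a2 a3; apply: eq_sw => x1 x2.
  by rewrite antipodeM -ractM mulrA.
(* Once [a_1 S(a_2)] is contracted, the Leibniz rule for [d(x_2 a)] gives the two terms of a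
   connection; in the second, [S(x_1) x_2] reduces to the counit. *)
rewrite (sw_cancel_idSl (F := fun y z => \sw_(x1, x2 <- Delta x)
    (ract n (y * S x1) (x) d (x2 * z)))) //.
rewrite (sw_lin (g := fun t => ract t a)) //.
transitivity ((\sw_(x1, x2 <- Delta x) (ract n (S x1) (x) ract (d x2) a)) +
    \sw_(x1, x2 <- Delta x) (ract n (S x1 * x2) (x) d a)).
  rewrite sw_add; apply: eq_sw => x1 x2.
  by rewrite mul1r calc_leibniz (linD (f := otimesA _)) // -tens_balance -ractM.
congr (_ + _); first by apply: eq_sw => x1 x2; rewrite tens_ract.
rewrite (sw_antipodel (F := fun y => ract n y (x) d a)) // ract1.
by rewrite (linZ (f := fun m => m (x) d a)).
Qed.

(** The factor [S(m_(2)) m_(3)] arising from [S] and [d] cancels; the rest is the compatibility of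
    the left and right coactions of [E]. *)
Lemma grassmann_left_covariant : left_covariant (lcoact E) (lcoact2 E) grassmann.
Proof.
move=> m; rewrite -[RHS]sw_otimes /tens_map.
rewrite [in RHS]/grassmann (sw_lin (g := fun t => tens_lift _ (lcoact2 E t))) //.
transitivity (\sw_(n, z <- rcoact E m) \sw_(y, n' <- lcoact E n)
    otimes y (\sw_(x1, x2 <- Delta z) (ract n' (S x1) (x) d x2))).
  rewrite -(sw_lcoact_rcoact Ebicov (F := fun y n' z =>
    otimes y (\sw_(x1, x2 <- Delta z) (ract n' (S x1) (x) d x2)))) //.
  by apply: eq_sw => y n; rewrite (sw_lin (g := otimes y)).
apply: eq_sw => n x; apply/esym.
rewrite (sw_lin (g := fun t => tens_lift _ (lcoact2 E t))) //.
transitivity (\sw_(x1, x2 <- Delta x) \sw_(y, n' <- lcoact E n)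
    \sw_(u, v <- Delta x1) \sw_(w1, w2 <- Delta x2)
    otimes (y * (S v * w1)) (ract n' (S u) (x) d w2)).
  apply: eq_sw => x1 x2; rewrite sw_lcoact2 // sw_lcoact_ract //.
  apply: eq_sw => y n'; rewrite sw_comul_antipode //.
  apply: eq_sw => u v; rewrite sw_lcoact_d //.
  by apply: eq_sw => w1 w2; rewrite mulrA.
rewrite sw_exchange; apply: eq_sw => y n'.
rewrite [LHS]sw_coassoc // (sw_lin (g := otimes y)) //; apply: eq_sw => u r.
rewrite (sw_cancel_Sidl (F := fun p q =>
  otimes (y * p) (ract n' (S u) (x) d q))) //.
by rewrite mulr1.
Qed.

(** The coaction of the image is [m_(0) S(m_(3)) (x) dm_(4)] with coefficient
    [m_(1) S(m_(2)) m_(5)], whose first two factors cancel. *)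
Lemma grassmann_right_covariant : right_covariant (rcoact E) (rcoact2 E) grassmann.
Proof.
move=> m; rewrite -[RHS]sw_otimes /tens_map.
rewrite [in RHS]/grassmann (sw_lin (g := fun t => tens_lift _ (rcoact2 E t))) //.
transitivity (\sw_(n, z <- rcoact E m) \sw_(x1, r <- Delta z) \sw_(x2, x3 <- Delta r)
    otimes (ract n (S x1) (x) d x2) x3).
  transitivity (\sw_(n, z <- rcoact E m) \sw_(n', y <- rcoact E n)
      \sw_(x1, x2 <- Delta y) otimes (ract n' (S x1) (x) d x2) z).
    apply: eq_sw => n z; rewrite (sw_lin (g := fun t => otimes t z)) //.
    by apply: eq_sw => n' y; rewrite (sw_lin (g := fun t => otimes t z)).
  rewrite sw_rcoact_coassoc //; apply: eq_sw => n x.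
  by rewrite [LHS]sw_coassoc.
apply/esym; transitivity (\sw_(n, x <- rcoact E m) \sw_(n', y <- rcoact E n)
    \sw_(x1, x2 <- Delta x) \sw_(u, v <- Delta x1) \sw_(w1, w2 <- Delta x2)
    otimes (ract n' (S v) (x) d w1) (y * S u * w2)).
  apply: eq_sw => n x.
  rewrite (sw_lin (g := fun t => tens_lift _ (rcoact2 E t))) // [RHS]sw_exchange.
  apply: eq_sw => x1 x2; rewrite sw_rcoact2 // sw_rcoact_ract //.
  apply: eq_sw => n' y; rewrite sw_comul_antipode //.
  by apply: eq_sw => u v; rewrite sw_rcoact_d.
rewrite sw_rcoact_coassoc //; apply: eq_sw => n z.
transitivity (\sw_(y, x <- Delta z) \sw_(u, r <- Delta x) \sw_(v, x2 <- Delta r)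
    \sw_(w1, w2 <- Delta x2) otimes (ract n (S v) (x) d w1) (y * S u * w2)).
  by apply: eq_sw => y x; rewrite [LHS]sw_coassoc.
rewrite (sw_cancel_idSl (F := fun p r => \sw_(v, x2 <- Delta r)
    \sw_(w1, w2 <- Delta x2) otimes (ract n (S v) (x) d w1) (p * w2))) //.
apply: eq_sw => v x2; apply: eq_sw => w1 w2.
by rewrite mul1r.
Qed.

End Grassmann.

(** * Removing the torsion with a projection onto the fixed space of [sigma] *)

Section Torsionless.
Variables (C : fieldType) (A : hopfAlgebra C) (E : calculus A).
Hypothesis Ebicov : bicovariant_calculus E.
Local Notation d := (calc_d E).
Local Notation "m (x) n" := (otimesA m n : tensor_bimod E E) (at level 40).
Let lL := lcoact_linear Ebicov.
Let rL := rcoact_linear Ebicov.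
Let l2L := lcoact2_linear Ebicov.
Let r2L := rcoact2_linear Ebicov.
Variable sigma : {linear tensor_bimod E E -> tensor_bimod E E}.
Hypothesis sigma_braiding : canonical_braiding sigma.

Lemma wedge_linear : linear (wedge sigma).
Proof. exact: proj_linear. Qed.
Let wL := wedge_linear.

Lemma wedge_fixed t : sigma t = t -> wedge sigma t = 0.
Proof.
move=> st; rewrite -(lin0 wL); apply/projP; rewrite subr0 /=.
by rewrite st subrr.
Qed.

(** The criterion for [a db |-> f (da (x) db)] to be well defined, used for [f = wedge] and
    [f = 1 - P]. *)
Lemma sum_dd_vanish (W : lmodType C) (f : tensor_bimod E E -> W) (s : seq (A * A)) :
  linear f -> (forall t, sigma t = t -> f t = 0) ->
  \sum_(p <- s) lact p.1 (d p.2) = 0 -> \sum_(p <- s) f (d p.1 (x) d p.2) = 0.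
Proof.
move=> fl f0 s0; rewrite -(lin_sum (f := f)) //; apply: f0.
exact: sigma_fixes_relations.
Qed.

Lemma ext_d_lact a b :
  ext_d sigma (lact a (d b)) = wedge sigma (d a (x) d b).
Proof.
rewrite /ext_d calc_ext_lact // => s; apply: sum_dd_vanish => //.
exact: wedge_fixed.
Qed.

Lemma ext_d_linear : linear (ext_d (E := E) sigma).
Proof.
apply: calc_ext_linear => // s; apply: sum_dd_vanish => //.
exact: wedge_fixed.
Qed.

Variable P : tensor_bimod E E -> tensor_bimod E E.
Hypotheses (PL : linear P) (P_r : forall t a, P (ract t a) = ract (P t) a).
Hypotheses (P_lcov : left_covariant (lcoact2 E) (lcoact2 E) P)
  (P_rcov : right_covariant (rcoact2 E) (rcoact2 E) P).
Hypotheses (P_fix : forall t, sigma t = t -> P t = t)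
  (sigmaP : forall t, sigma (P t) = P t).

(* The composite of [d : E -> Omega2] with the section [wedge t |-> t - P t]
   of [wedge]. *)
Definition lifted_d (w : E) : tensor_bimod E E :=
  calc_ext (fun a b => (d a (x) d b) - P (d a (x) d b)) w.

Let lifted_d0 (s : seq (A * A)) :
  \sum_(p <- s) lact p.1 (d p.2) = 0 ->
  \sum_(p <- s) ((d p.1 (x) d p.2) - P (d p.1 (x) d p.2)) = 0.
Proof.
apply: (sum_dd_vanish (f := fun t => t - P t)) => // t /P_fix ->.
exact: subrr.
Qed.

Lemma lifted_d_lact a b :
  lifted_d (lact a (d b)) = (d a (x) d b) - P (d a (x) d b).
Proof. by rewrite /lifted_d calc_ext_lact. Qed.

Lemma lifted_d_linear : linear lifted_d.
Proof. exact: calc_ext_linear. Qed.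
Let dL := lifted_d_linear.

(** The lift of [d(w a) = (dw) a - w /\ da]; right linearity of [P] lets the action of [a] pass
    through [1 - P]. *)
Lemma lifted_d_ract w a :
  lifted_d (ract w a) = ract (lifted_d w) a - ((w (x) d a) - P (w (x) d a)).
Proof.
pose Q t := t - P t; have QL : linear Q by rewrite /Q.
have dE x y : lifted_d (lact x (d y)) = Q (d x (x) d y) by exact: lifted_d_lact.
rewrite -/(Q _); move: w; apply: calc_ind => // x y.
rewrite ract_lact_d (linB (f := lifted_d)) // !dE.
have -> : ract (Q (d x (x) d y)) a = Q (d x (x) ract (d y) a).
  by rewrite /Q (linB (f := fun t => ract t a)) // -P_r tens_ract.
(* Two uses of the Leibniz rule: on [d(ya)], and on [(dx) y] after [y] crosses the tensor sign. *)
have -> : d x (x) d (y * a) =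
    ((d x (x) ract (d y) a) + (d (x * y) (x) d a)) - (lact x (d y) (x) d a).
  rewrite !calc_leibniz (linD (f := fun m => _ (x) m)) // -tens_balance.
  by rewrite (linD (f := fun m => m (x) d a)) // addrA addrK.
by rewrite (linB (f := Q)) // (linD (f := Q)) // addrAC addrK.
Qed.

Lemma lifted_d_left_covariant : left_covariant (lcoact E) (lcoact2 E) lifted_d.
Proof.
move=> w; rewrite -[RHS]sw_otimes /tens_map; move: w; apply: calc_ind => // a b.
rewrite lifted_d_lact sw_lcoact // (linB (f := fun t => tens_lift _ (lcoact2 E t))) //.
rewrite -(left_covariant_sw _ P_lcov) // sw_sub !sw_lcoact2 // sw_lcoact_d //.
apply: eq_sw => a1 a2; rewrite sw_lcoact_d //; apply: eq_sw => b1 b2.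
by rewrite lifted_d_lact (linB (f := otimes _)).
Qed.

Lemma lifted_d_right_covariant : right_covariant (rcoact E) (rcoact2 E) lifted_d.
Proof.
move=> w; rewrite -[RHS]sw_otimes /tens_map; move: w; apply: calc_ind => // a b.
rewrite lifted_d_lact sw_rcoact // (linB (f := fun t => tens_lift _ (rcoact2 E t))) //.
rewrite -(right_covariant_sw _ P_rcov) // sw_sub !sw_rcoact2 // sw_rcoact_d //.
apply: eq_sw => a1 a2; rewrite sw_rcoact_d //; apply: eq_sw => b1 b2.
by rewrite lifted_d_lact (linB (f := fun t => otimes t _)).
Qed.

Let gL := grassmann_linear Ebicov.

Lemma torsionless_connection :
  exists nabla : E -> tensor_bimod E E,
    [/\ right_connection nabla, bicovariant_connection nabla
      & torsionless sigma nabla].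
Proof.
(* Lifting the torsion of [grassmann] by [wedge t |-> t - P t] gives [(1 - P) grassmann + lifted_d];
   subtracting this from [grassmann] leaves the witness. *)
exists (fun w => P (grassmann w) - lifted_d w); split.
- split=> // w a; have [_ gr] := grassmann_connection Ebicov.
  (* The term [P (w (x) da)] from [grassmann] cancels against the one from [lifted_d], leaving
     [w (x) da]. *)
  rewrite gr (linD (f := P)) // P_r lifted_d_ract.
  rewrite (linB (f := fun t => ract t a)) //.
  rewrite [RHS]addrAC opprB [in LHS]addrA; congr (_ - _).
  by rewrite [X in _ + X]addrC addrA addrK.
- split.
    apply: left_covariant_sub => //; last exact: lifted_d_left_covariant.
    apply: left_covariant_comp P_lcov => //; exact: grassmann_left_covariant.
  apply: right_covariant_sub => //; last exact: lifted_d_right_covariant.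
  apply: right_covariant_comp P_rcov => //; exact: grassmann_right_covariant.
have eL := ext_d_linear.
apply: (calc_ind (g := fun=> 0)) => [||a b].
- by rewrite /torsion.
- by move=> c x y; rewrite scaler0 addr0.
(* [wedge] kills the range of [P], so only [- wedge (da (x) db)] survives, and it cancels
   [ext_d]. *)
rewrite /torsion ext_d_lact lifted_d_lact !(linB _ _ wL).
by rewrite !(wedge_fixed (sigmaP _)) subr0 sub0r addNr.
Qed.

End Torsionless.

Theorem theorem1p2 (R : realType) (A : hopfAlgebra R[i]) (E : calculus A)
    (Ebicov : bicovariant_calculus E)
    (findimL : finite_dimensional (left_invariant (lcoact E)))
    (findimR : finite_dimensional (right_invariant (rcoact E)))
    (sigma : {linear tensor_bimod E E -> tensor_bimod E E})
    (sigma_braiding : canonical_braiding sigma)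
    (sigma_diag :
      diagonalisable_on (left_invariant (lcoact2 E)) sigma) :
  exists nabla : E -> tensor_bimod E E,
    [/\ right_connection nabla, bicovariant_connection nabla
      & torsionless sigma nabla].
Proof.
have [s s1 sP] := diagonalisable_spectral_proj Ebicov sigma_braiding sigma_diag.
apply: (torsionless_connection Ebicov sigma_braiding (P := spectral_proj sigma s)).
- exact: spectral_proj_linear.
- exact: spectral_proj_ract.
- exact: spectral_proj_left_covariant.
- exact: spectral_proj_right_covariant.
- by move=> t; apply: spectral_proj_fix.
- exact: sP.
Qed.
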